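(* Let $g_1,\ldots,g_q$ be polynomials on $\mathbb{R}^n$ such that the set $\mathcal{K} = \{ x \in \mathbb{R}^n: g_1(x)\geq 0, \ldots, g_q(x) \geq 0 \}$ is compact and satisfies the Archimedean condition. Let $P(x)$ be an $m\times m$ polynomial matrix whose sparsity graph is chordal and has maximal cliques $\mathcal{C}_1,\ldots,\mathcal{C}_t$. If $P$ is strictly positive definite on $\mathcal{K}$, then there exist SOS matrices $S_{j,k}(x)$ of size $|\mathcal{C}_k| \times |\mathcal{C}_k|$, $j=0,\ldots,q$, $k=1,\ldots,t$, such that $$P(x) = \sum_{k=1}^t E_{\mathcal{C}_k}^{\mathsf T} \Big( S_{0,k}(x) + \sum_{j=1}^q g_j(x)S_{j,k}(x) \Big) E_{\mathcal{C}_k}.$$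
   Context: Polynomials have real coefficients and variables $x=(x_1,\ldots,x_n)$; $\|x\|^2=x_1^2+\cdots+x_n^2$. An $m\times m$ polynomial matrix $P$ is a symmetric matrix with polynomial entries. Its sparsity graph is the undirected graph with vertices $\{1,\ldots,m\}$ and edge set $\mathcal{E}$ such that, for $i\ne j$, $(i,j)\notin\mathcal{E}$ if and only if $P_{ij}\equiv 0$. A clique is a set of vertices that are pairwise connected by edges; it is maximal if not contained in any other clique. A graph is chordal if every cycle of length at least $4$ has a chord (an edge joining two nonconsecutive vertices of the cycle). For a clique $\mathcal{C}$, with elements listed as $\mathcal{C}(1),\ldots,\mathcal{C}(|\mathcal{C}|)$ in increasing order, $E_{\mathcal{C}}\in\mathbb{R}^{|\mathcal{C}|\times m}$ is the matrix with $(E_{\mathcal{C}})_{ij}=1$ if $\mathcal{C}(i)=j$ and $0$ otherwise. A polynomial matrix $S(x)$ is SOS if $S(x)=H(x)^{\mathsf T}H(x)$ for some (possibly rectangular) polynomial matrix $H(x)$; an SOS polynomial is a finite sum of squares of polynomials. The set $\mathcal{K}$ (with its description by $g_1,\ldots,g_q$) satisfies the Archimedean condition if there exist SOS polynomials $\sigma_0,\ldots,\sigma_q$ and a scalar $r\in\mathbb{R}$ such that $\sigma_0(x) + g_1(x) \sigma_1(x) + \cdots + g_q(x) \sigma_q(x) = r^2 - \|x\|^2$. *)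

(* Defs.v *)
From HB Require Import structures.
From mathcomp Require Import all_boot all_order all_algebra.
From mathcomp Require Import classical_sets reals topology normedtype.
(* The notations of mpoly clash with those of normedtype. *)
From mathcomp Require Import -(notations) mpoly.

Set Implicit Arguments.
Unset Strict Implicit.
Unset Printing Implicit Defensive.

Import Order.TTheory GRing.Theory Num.Theory.
Import numFieldNormedType.Exports.

Local Open Scope classical_set_scope.
Local Open Scope ring_scope.

Definition clique (T : finType) (e : rel T) (A : {set T}) : bool :=
  [forall x in A, forall y in A, (x != y) ==> e x y].

Definition chordal (T : finType) (e : rel T) : Prop :=
  forall p : seq T, ucycle e p -> (4 <= size p)%N ->
    exists x y : T, [/\ x \in p, y \in p, x != y,
                        (y != next p x) && (x != next p y) & e x y].

Definition posdefmx (R : realType) (m : nat) (A : 'M[R]_m) : Prop :=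
  A^T = A /\ forall v : 'cV[R]_m, v != 0 -> 0 < (v^T *m A *m v) 0 0.

(* E_C as a 0/1 matrix over an arbitrary ring, so that it can multiply
   polynomial matrices directly; [enum_val] lists C in increasing order. *)
Definition clique_mx (A : nzRingType) (m : nat) (C : {set 'I_m}) :
    'M[A]_(#|C|, m) :=
  \matrix_(i, j) (enum_val i == j)%:R.

Section Polynomials.
Variables (R : realType) (n : nat).
Local Notation poly := (mpoly n R).

Definition peval (x : 'rV[R]_n) (p : poly) : R :=
  meval (fun i => x 0 i) p.

Definition sparsity_graph (m : nat) (P : 'M[poly]_m) : rel 'I_m :=
  [rel i j | (i != j) && (P i j != 0)].

Definition sos_poly (p : poly) : Prop :=
  exists s : seq poly, p = \sum_(h <- s) h ^+ 2.

Definition sos_mx (m : nat) (S : 'M[poly]_m) : Prop :=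
  exists (r : nat) (H : 'M[poly]_(r, m)), S = H^T *m H.

Definition semialg_set (q : nat) (g : 'I_q -> poly) : set 'rV[R]_n :=
  [set x | forall j, 0 <= peval x (g j)].

Definition archimedean (q : nat) (g : 'I_q -> poly) : Prop :=
  exists (s0 : poly) (s : 'I_q -> poly) (r : R),
    [/\ sos_poly s0, forall j, sos_poly (s j) &
      s0 + \sum_(j < q) g j * s j =
      mpolyC n (r ^+ 2)
        - \sum_(i < n) (mpolyX R (mnm1 i)) ^+ 2].

End Polynomials.

(* Main.v *)
(* A polynomial f with f > 0 on K lies in the quadratic module M of g (Putinar):
   otherwise M - f * SOS is proper, a maximal quadratic module above it is total,
   and the Archimedean condition turns it into evaluation at a point of K where
   f <= 0.  For the matrix P, eliminate the vertices of a chordal graph one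
   simplicial vertex at a time: if a = P i i, b is the rest of column i and p is a
   polynomial with a * p close to 1 on K, then a (e_i + p b) (e_i + p b)^T has
   column i close to that of P, and subtracting it leaves a Schur complement
   supported on the smaller graph which is still uniformly positive definite.
   The small off-diagonal error c x y is written with (x + y)^2 and (x - y)^2.  In
   the end P is a sum of terms f v v^T with f > 0 on K and v supported in a clique,
   and only the scalar case of Putinar's theorem is needed. *)
Require Import Defs.
From HB Require Import structures.
From mathcomp Require Import all_boot all_order all_algebra.
From mathcomp Require Import classical_sets reals topology normedtype.
From mathcomp Require Import -(notations) mpoly.
From mathcomp Require Import boolp sequences derive ring lra.

Set Implicit Arguments.
Unset Strict Implicit.
Unset Printing Implicit Defensive.

Import Order.TTheory GRing.Theory Num.Theory.
Import numFieldNormedType.Exports.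

Local Open Scope classical_set_scope.
Local Open Scope ring_scope.

(** * Simplicial vertices of chordal graphs *)

Lemma next_cat_cons2 (T : eqType) (p1 p2 : seq T) (x y : T) :
  x \notin p1 -> next (p1 ++ x :: y :: p2) x = y.
Proof.
case: p1 => [|z p1]; first by rewrite next_nth inE eqxx /= eqxx.
rewrite inE negb_or => /andP[/negPf xz xp1].
rewrite next_nth !inE mem_cat inE eqxx !orbT /= eq_sym xz.
by rewrite index_cat (negPf xp1) /= eqxx addn0 nth_cat ltnNge leqnSn /= subSnn.
Qed.

Lemma next_last_head (T : eqType) (p : seq T) (x y : T) :
  y \notin x :: p -> next (x :: rcons p y) y = x.
Proof.
rewrite inE negb_or => /andP[/negPf xy yp].
rewrite next_nth inE mem_rcons inE eqxx orbT /= eq_sym xy.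
by rewrite nth_default // -cats1 index_cat (negPf yp) /= eqxx addn0 size_cat addn1.
Qed.

Section Simplicial.
Variables (T : finType) (e : rel T).
Hypotheses (e_sym : ssrbool.symmetric e) (e_irr : irreflexive e) (e_chordal : chordal e).

(** Closing the path through [u] gives a cycle whose chord cannot end at [u], since [u] sees only
    [s] and [s'] on it. The chord thus shortcuts the path, and induction on its length applies. *)
Lemma chordal_path_edge (u : T) (k : nat) (s : T) (p : seq T) (s' : T) :
  (size p <= k)%N -> path e s (rcons p s') -> s != s' -> e u s -> e u s' ->
  {in p, forall w, ~~ e u w && (w != u)} -> e s s'.
Proof.
elim: k s p s' => [|k IHk] s p s' szp ep ss' us us' pu.
  by move: szp ep; rewrite leqn0 size_eq0 => /eqP-> /=; rewrite andbT.
have nus w : e u w -> u != w by case: eqP => // <-; rewrite e_irr.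
(* A repeated vertex or a chord both give a shorter path. *)
have shorter p' : (size p' < size p)%N -> path e s (rcons p' s') ->
    {subset p' <= p} -> e s s'.
  move=> lt ep' sub; apply: (IHk s p' s') => //; first by rewrite -ltnS (leq_trans lt).
  by move=> w /sub /pu.
have [uq|nuq] := boolP (uniq (s :: rcons p s')); last first.
  have lastp' := last_rcons s p s'.
  case/shortenP: ep lastp' => p' ep' up' subp' lastp'.
  case/lastP: p' ep' up' subp' lastp' => [|p' z] ep' up' subp'.
    by rewrite /= => es; rewrite es eqxx in ss'.
  rewrite last_rcons => zs'; subst z.
  apply: (shorter p') => //; last first.
    move=> w wp'; have := subp' w; rewrite !mem_rcons !inE wp' orbT => /(_ isT).
    case/orP => // /eqP ws'; move: up'.
    by rewrite /= rcons_uniq -ws' wp' /= andbF.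
  rewrite ltnNge; apply: contra nuq => le_p.
  apply: (leq_size_uniq up'); last by rewrite /= !size_rcons !ltnS.
  by move=> w; rewrite !inE => /predU1P[->|/subp' ->]; rewrite ?eqxx ?orbT.
have [p0|pn0] := posnP (size p).
  by move: ep; rewrite (size0nil p0) /= andbT.
pose c := u :: s :: rcons p s'.
have unotin : u \notin s :: rcons p s'.
  rewrite inE negb_or nus // mem_rcons inE negb_or nus //=.
  by apply/negP => /pu; rewrite eqxx andbF.
have cyc : ucycle e c.
  apply/andP; split; last by rewrite cons_uniq unotin.
  by rewrite /c /cycle rcons_path /= us ep /= last_rcons e_sym us'.
have sz : (4 <= size c)%N by rewrite /c /= size_rcons !ltnS.
have [x [y [xc yc xy /andP[nx ny] exy]]] := e_chordal cyc sz.
(* On [c] the only neighbours of [u] are its cyclic successor [s] and predecessor [s']. *)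
have nochord z : z \in c -> z != next c u -> u != next c z -> ~~ e u z.
  rewrite inE => /predU1P[->|]; first by rewrite e_irr.
  rewrite inE => /predU1P[->|]; first by rewrite /c /= eqxx eqxx.
  rewrite mem_rcons inE => /predU1P[->|]; last by move/pu/andP => [].
  rewrite /c -rcons_cons next_last_head ?eqxx // inE negb_or eq_sym nus //=.
  by move: uq; rewrite -rcons_cons rcons_uniq => /andP[].
have xu : x != u.
  apply/negP => /eqP xu; move: (nochord y yc).
  by rewrite -xu nx ny exy => /(_ isT isT).
have yu : y != u.
  apply/negP => /eqP yu; move: (nochord x xc).
  by rewrite -yu nx ny e_sym exy => /(_ isT isT).
have {xc}xq : x \in s :: rcons p s' by move: xc; rewrite inE (negPf xu).
have {yc}yq : y \in s :: rcons p s' by move: yc; rewrite inE (negPf yu).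
(* A chord from [a] to a later [b] skips [q2], which is nonempty because [b] does not directly
   follow [a]. *)
have cut a b q1 q2 q3 : s :: rcons p s' = q1 ++ a :: q2 ++ b :: q3 -> e a b ->
    b != next c a -> e s s'.
  move=> qE eab nb.
  have q2n : (0 < size q2)%N.
    case: q2 qE nb => // qE; rewrite /c qE -cat_cons next_cat_cons2 ?eqxx //.
    have au : a != u by apply: contraNneq unotin => <-; rewrite qE mem_cat inE eqxx orbT.
    have : a \notin q1; last by rewrite inE negb_or au.
    by move: uq; rewrite qE cat_uniq /= negb_or => /and3P[_ /andP[]].
  have ss : subseq (q1 ++ a :: b :: q3) (s :: rcons p s').
    by rewrite qE cat_subseq //= eqxx suffix_subseq.
  have us'' := subseq_uniq ss uq.
  have szs : (size (q1 ++ a :: b :: q3) < size (s :: rcons p s'))%N.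
    by rewrite qE !size_cat /= size_cat /= ltn_add2l ltnS -[X in (X < _)%N]add0n ltn_add2r.
  have ep' : path e s (behead (q1 ++ a :: b :: q3)) && (head s (q1 ++ a :: b :: q3) == s)
      && (last s (q1 ++ a :: b :: q3) == s').
    have := last_rcons s p s'; move: eab.
    case: q1 qE {ss us'' szs} => [|z q1] /= [<- E] eab; move: ep; rewrite E.
      by rewrite cat_path last_cat /= eab eqxx => /and3P[_ _ ->] ->; rewrite eqxx.
    rewrite !(cat_path, last_cat) /= !(cat_path, last_cat) /= eqxx eab.
    by case/and4P => -> -> _ /andP[_ ->] ->; rewrite eqxx.
  have [p' pE] : exists p', q1 ++ a :: b :: q3 = s :: rcons p' s'.
    move: ep'; case/lastP: (q1 ++ _) (size_cat q1 (a :: b :: q3)) => [|[|z r] z'].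
    - by rewrite /= addnS.
    - by rewrite /= !addnS.
    by rewrite /= last_rcons => _ /andP[/andP[_ /eqP->] /eqP->]; exists r.
  move: ep' ss szs; rewrite pE /= !size_rcons !ltnS eqxx andbT => /andP[ep' _] ss szs.
  rewrite pE in us''; apply: (shorter p') => //.
  move=> v vp; have := mem_subseq ss => /(_ v).
  rewrite !mem_rcons !in_cons vp orbT => /(_ isT) /orP[/eqP vs|//].
  by move: us''; rewrite /= rcons_uniq -vs vp andbF.
have [q1 [q2 qE]] : exists q1 q2, s :: rcons p s' = q1 ++ x :: q2.
  by case/path.splitPr: xq => q1 q2; exists q1, q2.
move: yq; rewrite qE mem_cat inE eq_sym (negPf xy) /= => /orP[yq|yq].
  have [r1 [r2 rE]] : exists r1 r2, q1 = r1 ++ y :: r2.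
    by case/path.splitPr: yq => r1 r2; exists r1, r2.
  by apply: (cut y x r1 r2 q2); rewrite 1?e_sym // qE rE -catA.
have [r1 [r2 rE]] : exists r1 r2, q2 = r1 ++ y :: r2.
  by case/path.splitPr: yq => r1 r2; exists r1, r2.
by apply: (cut x y q1 r1 r2); rewrite // qE rE.
Qed.

Definition simplicial (V : {set T}) (v : T) : bool :=
  (v \in V) && clique e [set w in V | (w == v) || e v w].

Lemma cliqueP (A : {set T}) :
  reflect {in A &, forall x y, x != y -> e x y} (clique e A).
Proof.
apply: (iffP forall_inP) => [h x y xA yA xy|h x xA].
  by have /forall_inP/(_ y yA)/implyP := h x xA; apply.
by apply/forall_inP => y yA; apply/implyP; apply: h.
Qed.

Lemma subclique (A B : {set T}) : A \subset B -> clique e B -> clique e A.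
Proof.
by move=> /fintype.subsetP AB /cliqueP cB; apply/cliqueP => x y /AB xB /AB; apply: cB.
Qed.

(* Dirac's argument: the neighbours S of a connected component W of the
   non-neighbours of u form a clique, and one recurses into W :|: S. *)
Lemma simplicial_nonneighbour (V : {set T}) (u v : T) :
  u \in V -> v \in V -> v != u -> ~~ e u v ->
  exists2 w, simplicial V w & (w != u) && ~~ e u w.
Proof.
have [k] := ubnP #|V|; elim: k V u v => // k IHk V u v; rewrite ltnS => Vk uV vV vu euv.
pose far w := [&& w \in V, w != u & ~~ e u w].
pose ef := [rel x y | [&& e x y, far x & far y]].
pose W := [set w | connect ef v w]%SET.
pose S := [set s in V | [&& s \notin W & [exists w in W, e w s]]].
have ef_sym : ssrbool.symmetric ef by move=> x y; rewrite /= e_sym [far x && _]andbC.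
have farv : far v by rewrite /far vV vu euv.
have farW w : w \in W -> far w.
  rewrite inE => /connectP[p]; case/lastP: p => [_ -> //|p z].
  by rewrite last_rcons rcons_path => /andP[_ /and3P[_ _ fz]] ->.
have WV w : w \in W -> w \in V by move/farW/and3P => [].
have SV s : s \in S -> s \in V by rewrite inE => /andP[].
have uS s : s \in S -> e u s.
  rewrite inE => /and3P[sV sW /exists_inP[w wW ews]].
  apply: contraR sW => eus; rewrite inE; apply: (connect_trans (y := w)).
    by rewrite inE in wW.
  apply: connect1; rewrite /= ews farW //= /far sV eus andbT /=.
  by apply: contraTneq (farW w wW) => su; rewrite /far -su [e s w]e_sym ews !andbF.
(* Neighbours of [s] and [s'] in [W] are joined by a path inside [W], which avoids [u] and its
   neighbours. *)
have cS : clique e S.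
  apply/cliqueP => s s' sS s'S ss'.
  move: (sS) (s'S); rewrite !inE => /and3P[_ _ /exists_inP[w wW ews]].
  case/and3P=> _ _ /exists_inP[w' w'W ews'].
  have /connectP[p pp w'E] : connect ef w w'.
    apply: (connect_trans (y := v)); last by rewrite inE in w'W.
    by rewrite (@sym_connect_sym _ ef) //; rewrite inE in wW.
  apply: (@chordal_path_edge u (size (w :: p)) s (w :: p) s') => //.
  - rewrite /= [e s w]e_sym ews rcons_path -w'E ews' andbT.
    by apply: sub_path pp => x y /andP[].
  - by rewrite uS.
  - by rewrite uS.
  have farp : all far (w :: p).
    rewrite /= farW //=; elim: (p) (w) pp => //= y q IH x /andP[/and3P[_ _ ->]] /IH.
    by [].
  by move=> x /(allP farp) /and3P[_ -> ->].
pose V' := W :|: S.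
have uV' : u \notin V'.
  rewrite inE negb_or; apply/andP; split; apply/negP.
    by move/farW; rewrite /far eqxx andbF.
  by move/uS; rewrite e_irr.
have V'V : V' \subset V.
  by apply/fintype.subsetP => x; rewrite inE => /orP[/WV|/SV].
have V'k : (#|V'| < k)%N.
  apply: leq_trans Vk; apply: proper_card; rewrite properE V'V /=.
  by apply/subsetPn; exists u.
have vW : v \in W by rewrite inE connect0.
have vV' : v \in V' by rewrite inE vW.
(* All neighbours in [V] of a vertex of [W] lie in [V'], so simpliciality of such a vertex passes
   from [V'] to [V]. *)
suff [w wW sw] : exists2 w, w \in W & simplicial V' w.
  have /and3P[wV wu euw] := farW w wW; exists w; last by rewrite wu.
  rewrite /simplicial wV /=; move: sw => /andP[_]; apply: subclique.
  apply/fintype.subsetP => x; rewrite !inE => /andP[xV xw]; rewrite xw andbT.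
  case/orP: xw => [/eqP->|ewx]; first by rewrite inE in wW; rewrite wW.
  have [//|/= xW] := boolP (connect ef v x).
  by rewrite xV; apply/exists_inP; exists w.
have SnW s : s \in S -> s \notin W by rewrite inE => /and3P[].
(* Recursing from [s] yields a simplicial non-neighbour of [s]; it is in [W] because [S] is a
   clique. *)
have [/exists_inP[s sS /exists_inP[w wV' /andP[ws esw]]]|nS] :=
    boolP [exists s in S, exists w in V', (w != s) && ~~ e s w].
  have sV' : s \in V' by rewrite inE sS orbT.
  have [z sz /andP[zs esz]] := IHk V' s w V'k sV' wV' ws esw.
  exists z => //; have /andP[zV' _] := sz.
  move: zV'; rewrite inE => /orP[//|zS].
  by move: esz; rewrite (cliqueP _ cS) // eq_sym.
(* Otherwise every vertex of [S] is adjacent to all of [V'], so a vertex of [V'] with a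
   non-neighbour in [V'] lies in [W]. *)
have Suniv s w : s \in S -> w \in V' -> w != s -> e s w.
  move=> sS wV' ws; apply: contraR nS => esw; apply/exists_inP; exists s => //.
  by apply/exists_inP; exists w; rewrite ?ws.
have [cV'|] := boolP (clique e V').
  exists v => //; rewrite /simplicial vV' /=; apply: subclique cV'.
  by apply/fintype.subsetP => x; rewrite inE => /andP[].
rewrite /clique => /forall_inPn[x xV'] /forall_inPn[y yV'].
rewrite negb_imply => /andP[xy exy].
have yx : y != x by rewrite eq_sym.
have [z sz /andP[zx exz]] := IHk V' x y V'k xV' yV' yx exy.
exists z => //; have /andP[zV' _] := sz.
move: zV'; rewrite inE => /orP[//|zS].
by move: exz; rewrite e_sym Suniv // eq_sym.
Qed.

Lemma exists_simplicial (V : {set T}) : V != finset.set0 -> exists v, simplicial V v.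
Proof.
case/finset.set0Pn=> v vV; have [cV|] := boolP (clique e V).
  exists v; rewrite /simplicial vV; apply: subclique cV.
  by apply/fintype.subsetP => x; rewrite inE => /andP[].
case/forall_inPn=> x xV /forall_inPn[y yV]; rewrite negb_imply => /andP[xy exy].
by have [|w sw _] := simplicial_nonneighbour xV yV _ exy; [rewrite eq_sym | exists w].
Qed.

End Simplicial.

(** * Putinar's Positivstellensatz *)

Section QuadraticModule.
Variables (R : realType) (n : nat).
Local Notation poly := (mpoly n R).
Local Notation "c %:C" := (mpolyC n c) (at level 1, format "c %:C").

(** Constants and variables generate the polynomial ring. This induction serves for boundedness
    modulo a quadratic module, for evaluation as a limit, and for continuity. *)
Lemma mpoly_subalg_ind (S : poly -> Prop) :
  (forall c, S c%:C) -> (forall i, S (mpolyX R (mnm1 i))) ->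
  (forall f g, S f -> S g -> S (f + g)) -> (forall f g, S f -> S g -> S (f * g)) ->
  forall f, S f.
Proof.
move=> SC SX SD SM; apply: mpolyind => [|c m p _ _ Sp]; first by rewrite -mpolyC0.
apply: (SD) => //; rewrite -mul_mpolyC; apply: (SM) => //; rewrite mpolyXE_id.
apply: (big_ind S) => //; first by rewrite -mpolyC1.
move=> i _; elim: (fun_of_multinom m i) => [|k IHk]; first by rewrite expr0 -mpolyC1.
by rewrite exprS; apply: SM.
Qed.

(** Polynomials form no field, so identities with halves or quarters are proved by multiplying by
    this 1 and letting [ring] treat the inverse constant as an atom. *)
Lemma mpolyC_natVK k : (0 < k)%N -> (k%:R^-1 : R)%:C * k%:R = 1 :> poly.
Proof.
move=> k0; rewrite -[X in _ * X](rmorph_nat (@mpolyC n R)) -rmorphM /=.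
by rewrite mulVf ?mpolyC1 // pnatr_eq0 -lt0n.
Qed.

Lemma sos_poly0 : sos_poly (0 : poly).
Proof. by exists [::]; rewrite big_nil. Qed.

Lemma sos_poly_sqr (h : poly) : sos_poly (h ^+ 2).
Proof. by exists [:: h]; rewrite big_seq1. Qed.

Lemma sos_polyD (s t : poly) : sos_poly s -> sos_poly t -> sos_poly (s + t).
Proof. by move=> [l ->] [l' ->]; exists (l ++ l'); rewrite big_cat. Qed.

Lemma sos_polyM2 (h s : poly) : sos_poly s -> sos_poly (h ^+ 2 * s).
Proof.
move=> [l ->]; exists (map ( *%R h) l).
by rewrite big_map mulr_sumr; apply: eq_bigr => k _; rewrite exprMn.
Qed.

(** Properness, [~ Q (-1)], is kept apart, so that a generated module can be formed before it is
    known to be proper. *)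
Definition quadratic_module (Q : set poly) : Prop :=
  [/\ Q 1, forall f g, Q f -> Q g -> Q (f + g) & forall h f, Q f -> Q (h ^+ 2 * f)].

Section Closure.
Variables (Q : set poly).
Hypothesis qmQ : quadratic_module Q.

Lemma qmD f g : Q f -> Q g -> Q (f + g). Proof. by case: qmQ => _ + _; apply. Qed.

Lemma qmM2 h f : Q f -> Q (h ^+ 2 * f). Proof. by case: qmQ => _ _; apply. Qed.

Lemma qm_sqr h : Q (h ^+ 2). Proof. by rewrite -[_ ^+ 2]mulr1; apply: qmM2; case: qmQ. Qed.

Lemma mpolyC_sqrt (c : R) : 0 <= c -> c%:C = (Num.sqrt c)%:C ^+ 2.
Proof. by move=> c0; rewrite -rmorphXn /= sqr_sqrtr. Qed.

Lemma qmZ (c : R) f : 0 <= c -> Q f -> Q (c%:C * f).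
Proof. by move=> /mpolyC_sqrt-> Qf; apply: qmM2. Qed.

Lemma qmC (c : R) : 0 <= c -> Q c%:C.
Proof. by move=> /mpolyC_sqrt->; apply: qm_sqr. Qed.

Lemma qm_sos s f : sos_poly s -> Q f -> Q (s * f).
Proof.
case=> l -> Qf; rewrite mulr_suml; apply: big_ind => [||h _]; last exact: qmM2.
- by rewrite -mpolyC0; apply: qmC.
- exact: qmD.
Qed.

(* 2 N (N^2 - f^2) = (N + f)^2 (N - f) + (N - f)^2 (N + f) *)
Lemma qm_sqr_bound (N : R) f : 0 < N -> Q (N%:C - f) -> Q (N%:C + f) ->
  Q (N%:C ^+ 2 - f ^+ 2).
Proof.
move=> N0 Qm Qp.
have -> : N%:C ^+ 2 - f ^+ 2 =
    ((2 * N)^-1)%:C * ((N%:C + f) ^+ 2 * (N%:C - f) + (N%:C - f) ^+ 2 * (N%:C + f)).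
  have h : ((2 * N)^-1)%:C * (2 * N%:C) = 1.
    rewrite -[X in _ * (X * _)](rmorph_nat (@mpolyC n R)) -!rmorphM /= mulVf ?mpolyC1 //.
    by rewrite lt0r_neq0 ?mulr_gt0.
  by rewrite -[LHS]mul1r -h; ring.
apply: qmZ; first by rewrite invr_ge0 mulr_ge0 // ltW.
by apply: qmD; apply: qmM2.
Qed.

Lemma qm_le_C (c d : R) f : c <= d -> Q (c%:C + f) -> Q (d%:C + f).
Proof.
move=> cd Qc; have -> : d%:C + f = (d - c)%:C + (c%:C + f) by rewrite rmorphB /=; ring.
by apply: qmD => //; apply: qmC; rewrite subr_ge0.
Qed.

(** The elements bounded modulo [Q] form a subalgebra: squares are handled by [qm_sqr_bound],
    products by polarization, and the variables by the Archimedean hypothesis. *)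
Lemma qm_archimedean (r : R) :
  Q ((r ^+ 2)%:C - \sum_(i < n) (mpolyX R (mnm1 i)) ^+ 2) ->
  forall f, exists2 N : R, 0 < N & Q (N%:C - f) /\ Q (N%:C + f).
Proof.
move=> Qr.
pose bdd f := exists2 N : R, 0 < N & Q (N%:C - f) /\ Q (N%:C + f).
have bddD f g : bdd f -> bdd g -> bdd (f + g).
  move=> [N N0 [Nm Np]] [M M0 [Mm Mp]]; exists (N + M); rewrite ?addr_gt0 // rmorphD /=.
  split.
    have -> : N%:C + M%:C - (f + g) = (N%:C - f) + (M%:C - g) by ring.
    exact: qmD.
  have -> : N%:C + M%:C + (f + g) = (N%:C + f) + (M%:C + g) by ring.
  exact: qmD.
have bddN f : bdd f -> bdd (- f).
  by move=> [N N0 [Nm Np]]; exists N => //; rewrite opprK.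
have bddC (c : R) : bdd c%:C.
  exists (`|c| + 1); first by rewrite ltr_wpDl.
  have := ler_norm c; have := ler_norm (- c); rewrite normrN => h1 h2.
  by rewrite -rmorphB -rmorphD; split; apply: qmC; lra.
have bdd2 f : bdd f -> bdd (f ^+ 2).
  move=> [N N0 [Nm Np]]; exists (N ^+ 2); rewrite ?exprn_gt0 //; split.
    by rewrite rmorphXn; apply: qm_sqr_bound.
  by apply: qmD; [apply: qmC; rewrite sqr_ge0 | apply: qm_sqr].
have bddZ (c : R) f : 0 < c -> bdd f -> bdd (c%:C * f).
  move=> c0 [N N0 [Nm Np]]; exists (c * N); rewrite ?mulr_gt0 // rmorphM /= -mulrDr -mulrBr.
  by split; apply: qmZ => //; apply: ltW.
apply: mpoly_subalg_ind => // [i|f g bf bg].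
  (* [(r^2 + 1) / 2 -+ X] is half of [(r^2 - X^2) + (X -+ 1)^2]. *)
  exists ((r ^+ 2 + 1) / 2); first by rewrite divr_gt0 // ltr_wpDl ?sqr_ge0.
  set X := mpolyX R _.
  have QX : Q ((r ^+ 2)%:C - X ^+ 2).
    rewrite (bigD1 i) //= opprD addrA in Qr.
    rewrite -[X in Q X](subrK (\sum_(j < n | j != i) (mpolyX R (mnm1 j)) ^+ 2)).
    apply: qmD => //; apply: big_ind => [||j _]; [|exact: qmD|exact: qm_sqr].
    by rewrite -mpolyC0; apply: qmC.
  have h := mpolyC_natVK (isT : 0 < 2)%N.
  have -> : ((r ^+ 2 + 1) / 2)%:C = (2^-1)%:C * ((r ^+ 2)%:C + 1) :> poly.
    by rewrite -mpolyC1 -rmorphD -rmorphM mulrC.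
  have -> : X = (2^-1)%:C * 2 * X by rewrite h mul1r.
  have -> : (2^-1)%:C * ((r ^+ 2)%:C + 1) - (2^-1)%:C * 2 * X =
      (2^-1)%:C * (((r ^+ 2)%:C - X ^+ 2) + (X - 1) ^+ 2) by ring.
  have -> : (2^-1)%:C * ((r ^+ 2)%:C + 1) + (2^-1)%:C * 2 * X =
      (2^-1)%:C * (((r ^+ 2)%:C - X ^+ 2) + (X + 1) ^+ 2) by ring.
  by split; apply: qmZ; rewrite ?invr_ge0 //; apply: qmD => //; apply: qm_sqr.
have h := mpolyC_natVK (isT : 0 < 4)%N.
have -> : f * g = (4^-1)%:C * ((f + g) ^+ 2 - (f - g) ^+ 2).
  by rewrite -[LHS]mul1r -h; ring.
by apply: bddZ; rewrite ?invr_gt0 //; apply: (bddD); [|apply: (bddN)];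
  apply: bdd2; apply: (bddD) => //; apply: (bddN).
Qed.

End Closure.

Lemma max_quadratic_module (M : set poly) :
  quadratic_module M -> ~ M (-1) ->
  exists Q, [/\ quadratic_module Q, M `<=` Q, ~ Q (-1) &
     forall Q', quadratic_module Q' -> Q `<=` Q' -> ~ Q' (-1) -> Q' `<=` Q].
Proof.
move=> qmM M1.
(* Joining [M] inside the predicate covers the empty chain, whose union [set0] then stands for
   [M]. *)
pose F (A : set poly) := quadratic_module (A `|` M) /\ ~ (A `|` M) (-1).
have [|A [[qmA A1] maxA]] := @Zorn_bigcup _ F.
  move=> G GF totG; have [[A0 GA0]|nG] := pselect (exists A, G A); last first.
    have -> : \bigcup_(X in G) X = set0.
      by rewrite -subset0 => x [A GA]; case: nG; exists A.
    by rewrite /F set0U.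
  have inA A f : G A -> (A `|` M) f -> (\bigcup_(X in G) X `|` M) f.
    by move=> GA [Af|Mf]; [left; exists A | right].
  have exA f : (\bigcup_(X in G) X `|` M) f -> exists2 A, G A & (A `|` M) f.
    by case=> [[A GA Af]|Mf]; [exists A => //; left | exists A0 => //; right].
  split; last by move=> /exA [A /GF[_ nA]].
  split; first by right; case: qmM.
    move=> f g /exA[A GA Af] /exA[B GB Bg].
    have [[qA _] [qB _]] := (GF _ GA, GF _ GB).
    have [sAB|sBA] := totG A B GA GB.
      by apply: (inA B) => //; apply: (qmD qB) => //; apply: (setSU sAB).
    by apply: (inA A) => //; apply: (qmD qA) => //; apply: (setSU sBA).
  move=> h f /exA[A GA Af]; apply: (inA A) => //.
  by have [qA _] := GF _ GA; apply: qmM2.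
exists (A `|` M); split => // Q' qmQ' AQ' nQ'.
have Q'E : Q' `|` M = Q' by apply/setUidPl => f Mf; apply: AQ'; right.
apply: contrapT => nsub; apply: (maxA Q'); last by rewrite /F Q'E.
split; first by move=> f Af; apply: AQ'; left.
by move=> Q'A; apply: nsub => f /Q'A; left.
Qed.

(** * From a maximal quadratic module to a point of the real space *)

Section Points.
Variables (Q : set poly).
Hypotheses (qmQ : quadratic_module Q) (nQ : ~ Q (-1)).
Hypothesis maxQ : forall Q', quadratic_module Q' -> Q `<=` Q' -> ~ Q' (-1) -> Q' `<=` Q.

Lemma qm_extend (a : poly) :
  quadratic_module [set f | exists q s, [/\ Q q, sos_poly s & f = q + s * a]].
Proof.
split=> [|f g [q [s [Qq ss ->]]] [q' [s' [Qq' ss' ->]]]|h f [q [s [Qq ss ->]]]].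
- exists 1, 0; split; [by case: qmQ | exact: sos_poly0 |].
  by rewrite mul0r addr0.
- exists (q + q'), (s + s'); split; [exact: qmD | exact: sos_polyD |].
  by rewrite mulrDl addrACA.
exists (h ^+ 2 * q), (h ^+ 2 * s); split; [exact: qmM2 | exact: sos_polyM2 |].
by rewrite mulrDr mulrA.
Qed.

Lemma sos_poly_qm s : sos_poly s -> Q s.
Proof.
by move=> ss; rewrite -[s]mulr1; apply: (qm_sos qmQ) => //; case: qmQ.
Qed.

(** By maximality, the module generated by [Q] and [a] contains [-1] as soon as it is larger than
    [Q]. *)
Lemma max_qm_neg1 a : ~ Q a -> exists q s, [/\ Q q, sos_poly s & -1 = q + s * a].
Proof.
move=> nQa; apply: contrapT => h; apply: nQa.
apply: (maxQ (qm_extend a)) => //.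
  move=> f Qf; exists f, 0; split=> //; first exact: sos_poly0.
  by rewrite mul0r addr0.
exists 0, 1; split; last by rewrite mul1r add0r.
  by rewrite -mpolyC0; apply: (qmC qmQ).
by rewrite -(expr1n _ 2); apply: sos_poly_sqr.
Qed.

Lemma qm_ideal f h : Q f -> Q (- f) -> Q (h * f).
Proof.
move=> Qf Qnf.
have e := mpolyC_natVK (isT : 0 < 4)%N.
have -> : h * f = (4^-1)%:C * ((h + 1) ^+ 2 * f + (h - 1) ^+ 2 * - f).
  by rewrite -[LHS]mul1r -{1}e; ring.
by apply: (qmZ qmQ); rewrite ?invr_ge0 //; apply: (qmD qmQ); apply: (qmM2 qmQ).
Qed.

(** If neither lies in [Q], eliminating [a] between [-1 = q1 + s1 a] and [-1 = q2 - s2 a] puts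
    [- s1] in [Q]; then [s1 a] lies in [Q] by [qm_ideal], and so does [-1]. *)
Lemma max_qm_total a : Q a \/ Q (- a).
Proof.
have [|/max_qm_neg1[q1 [s1 [Qq1 ss1 e1]]]] := pselect (Q a); first by left.
right; apply: contrapT => /max_qm_neg1[q2 [s2 [Qq2 ss2 e2]]].
have Qs1 : Q (- s1).
  have -> : - s1 = s2 + s2 * q1 + s1 * q2.
    have e1' : s1 * a = - 1 - q1 by rewrite e1 addrAC subrr add0r.
    have e2' : s2 * a = 1 + q2.
      by rewrite -[1]opprK e2 mulrN opprD opprK addrAC addNr add0r.
    have : s2 * (s1 * a) = s1 * (s2 * a) by ring.
    rewrite e1' e2' => e; have -> : s2 + s2 * q1 = - (s2 * (- 1 - q1)) by ring.
    by rewrite e; ring.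
  apply: (qmD qmQ); last exact: (qm_sos qmQ).
  by apply: (qmD qmQ); [apply: sos_poly_qm | apply: (qm_sos qmQ)].
apply: nQ; rewrite e1; apply: (qmD qmQ) => //; rewrite mulrC.
by apply: qm_ideal => //; apply: sos_poly_qm.
Qed.

Lemma qm_C_ge0 (c : R) : Q c%:C -> 0 <= c.
Proof.
move=> Qc; rewrite leNgt; apply/negP => c0; apply: nQ.
have -> : -1 = ((- c)^-1)%:C * c%:C :> poly.
  by rewrite -rmorphM /= invrN mulNr mulVf ?ltr0_neq0 // rmorphN1.
by apply: (qmZ qmQ) => //; rewrite invr_ge0; lra.
Qed.

(* [qm_near f r]: the ring homomorphism to R associated with Q sends f to r. *)
Definition qm_near (f : poly) (r : R) :=
  forall eps : R, 0 < eps -> Q (eps%:C + (r%:C - f)) /\ Q (eps%:C - (r%:C - f)).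

Lemma qm_nearD f g r s : qm_near f r -> qm_near g s -> qm_near (f + g) (r + s).
Proof.
move=> nf ng eps eps0; have e2 : 0 < eps / 2 by lra.
have [[f1 f2] [g1 g2]] := (nf _ e2, ng _ e2).
have -> : eps%:C = (eps / 2)%:C + (eps / 2)%:C :> poly by rewrite -rmorphD /= -splitr.
set e := (eps / 2)%:C in f1 f2 g1 g2 *.
have -> : (r + s)%:C - (f + g) = (r%:C - f) + (s%:C - g) by rewrite rmorphD /=; ring.
split; first by rewrite addrACA; apply: (qmD qmQ).
by rewrite opprD addrACA; apply: (qmD qmQ).
Qed.

Lemma qm_nearC c : qm_near c%:C c.
Proof.
move=> eps eps0; rewrite subrr subr0 addr0.
by split; apply: (qmC qmQ); apply: ltW.
Qed.

Lemma qm_nearN f r : qm_near f r -> qm_near (- f) (- r).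
Proof.
move=> nf eps /nf[h1 h2]; have -> : (- r)%:C - - f = - (r%:C - f) by rewrite rmorphN; ring.
by rewrite opprK.
Qed.

Lemma qm_nearB f g r s : qm_near f r -> qm_near g s -> qm_near (f - g) (r - s).
Proof. by move=> nf ng; apply: qm_nearD => //; apply: qm_nearN. Qed.

Lemma qm_nearZ c f r : qm_near f r -> qm_near (c%:C * f) (c * r).
Proof.
have pos d : 0 < d -> qm_near f r -> qm_near (d%:C * f) (d * r).
  move=> d0 nf eps eps0; have e0 : 0 < eps / d by rewrite divr_gt0.
  have [h1 h2] := nf _ e0.
  have -> : eps = d * (eps / d) by rewrite mulrC divfK // lt0r_neq0.
  rewrite (mpolyCM _ d (eps / d)) (mpolyCM _ d r) -mulrBr -mulrDr -mulrBr.
  by split; apply: (qmZ qmQ) => //; apply: ltW.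
move=> nf; have [c0|c0|->] := ltrgt0P c; first exact: pos.
  have -> : c%:C * f = - ((- c)%:C * f) by rewrite rmorphN mulNr opprK.
  have -> : c * r = - (- c * r) by rewrite mulNr opprK.
  by apply: qm_nearN; apply: pos => //; rewrite oppr_gt0.
by rewrite mpolyC0 !mul0r -mpolyC0; apply: qm_nearC.
Qed.

Lemma qm_near0_sqr f : qm_near f 0 -> qm_near (f ^+ 2) 0.
Proof.
move=> nf eps eps0; rewrite mpolyC0 sub0r opprK; split; last first.
  by apply: (qmD qmQ); [apply: (qmC qmQ); apply: ltW | apply: (qm_sqr qmQ)].
have s0 : 0 < Num.sqrt eps by rewrite sqrtr_gt0.
have [] := nf _ s0; rewrite mpolyC0 sub0r opprK => h1 h2.
by rewrite (mpolyC_sqrt (ltW eps0)); apply: (qm_sqr_bound qmQ).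
Qed.

(** After both factors are centred, the product of infinitesimals is polarized into squares, which
    [qm_near0_sqr] controls. *)
Lemma qm_nearM f g r s : qm_near f r -> qm_near g s -> qm_near (f * g) (r * s).
Proof.
move=> nf ng.
have nf0 : qm_near (f - r%:C) 0.
  by rewrite -(subrr r); apply: qm_nearB => //; apply: qm_nearC.
have ng0 : qm_near (g - s%:C) 0.
  by rewrite -(subrr s); apply: qm_nearB => //; apply: qm_nearC.
have nfg : qm_near ((f - r%:C) * (g - s%:C)) 0.
  have e := mpolyC_natVK (isT : 0 < 4)%N.
  have -> : (f - r%:C) * (g - s%:C) = (4^-1)%:C * (((f - r%:C) + (g - s%:C)) ^+ 2
      - ((f - r%:C) - (g - s%:C)) ^+ 2).
    by rewrite -[LHS]mul1r -{1}e; ring.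
  rewrite -[X in qm_near _ X](mulr0 4^-1); apply: qm_nearZ.
  rewrite -[X in qm_near _ X](subrr 0); apply: qm_nearB; apply: qm_near0_sqr.
    by rewrite -[X in qm_near _ X](addr0 0); apply: qm_nearD.
  by rewrite -[X in qm_near _ X](subrr 0); apply: qm_nearB.
have -> : f * g = ((f - r%:C) * (g - s%:C) + r%:C * g) + (s%:C * (f - r%:C)) by ring.
have -> : r * s = (0 + r * s) + s * 0 by rewrite mulr0 addr0 add0r.
by apply: qm_nearD; [apply: qm_nearD => //|]; apply: qm_nearZ.
Qed.

Hypothesis archQ : forall f, exists2 N : R, 0 < N & Q (N%:C - f) /\ Q (N%:C + f).

(** The value is a cut: the infimum of the constants [r] with [r - f] in [Q]. Totality of [Q]
    handles the constants below it. *)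
Lemma qm_near_exists f : exists r, qm_near f r.
Proof.
have [N N0 [Nm Np]] := archQ f.
pose A : set R := [set r | Q (r%:C - f)].
have A0 : A !=set0 by exists N.
have lbA : has_lbound A.
  exists (- N) => r Ar; rewrite -subr_ge0 opprK; apply: qm_C_ge0.
  have -> : (r + N)%:C = (r%:C - f) + (N%:C + f) by rewrite rmorphD /=; ring.
  exact: (qmD qmQ).
exists (inf A) => eps eps0; split.
  have [r Ar ri] : exists2 r, A r & r < inf A + eps by apply: inf_lt; rewrite ?ltrDl.
  have := qm_le_C qmQ (ltW ri) Ar.
  by rewrite rmorphD /= addrCA addrA.
have nA : ~ A (inf A - eps).
  by move=> /(ge_inf lbA); rewrite lerBrDr gerDl leNgt eps0.
have [//|] := max_qm_total ((inf A - eps)%:C - f).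
congr Q; rewrite rmorphB /=; ring.
Qed.

Lemma max_qm_eval : exists x : 'rV[R]_n, forall f, Q f -> 0 <= peval x f.
Proof.
pose x : 'rV[R]_n := \row_i xget 0 (qm_near (mpolyX R (mnm1 i))).
have near f : qm_near f (peval x f).
  elim/mpoly_subalg_ind: f => [c|i|f g nf ng|f g nf ng].
  - by rewrite /peval mevalC; apply: qm_nearC.
  - rewrite /peval mevalXU mxE; have [r nr] := qm_near_exists (mpolyX R (mnm1 i)).
    exact: (xgetI 0 nr).
  - by rewrite /peval mevalD; apply: qm_nearD.
  by rewrite /peval mevalM; apply: qm_nearM.
exists x => f Qf; rewrite leNgt; apply/negP => fx.
(* With [eps = - f(x) / 2], adding [f] leaves the negative constant [f(x) / 2] in [Q]. *)
have [|h _] := near f (- peval x f / 2); first by lra.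
suff : 0 <= - peval x f / 2 + peval x f by lra.
apply: qm_C_ge0; have -> : (- peval x f / 2 + peval x f)%:C =
    (- peval x f / 2)%:C + ((peval x f)%:C - f) + f by rewrite rmorphD /=; ring.
exact: (qmD qmQ).
Qed.

End Points.

(* If f were outside the module, the module generated by -f would be proper,
   and a maximal extension of it would yield a point of K with f <= 0; hence
   f t = 1 + s, and the identity for N^2 (f + r - 1/N) lets r decrease below 0. *)
Lemma positivstellensatz (M : set poly) (f : poly) :
  quadratic_module M ->
  (forall f, exists2 N : R, 0 < N & M (N%:C - f) /\ M (N%:C + f)) ->
  (forall x : 'rV[R]_n, (forall h, M h -> 0 <= peval x h) -> 0 < peval x f) -> M f.
Proof.
move=> qmM archM posf.
have [s [t [Ms st e]]] : exists s t, [/\ M s, sos_poly t & -1 = s + t * - f].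
  pose M' := [set h | exists q s, [/\ M q, sos_poly s & h = q + s * - f]].
  have qmM' : quadratic_module M' by apply: qm_extend.
  have MM' h : M h -> M' h.
    move=> Mh; exists h, 0; split => //; first exact: sos_poly0.
    by rewrite mul0r addr0.
  apply: contrapT => nM'; have [Q [qmQ M'Q nQ maxQ]] := max_quadratic_module qmM' nM'.
  have archQ h : exists2 N : R, 0 < N & Q (N%:C - h) /\ Q (N%:C + h).
    by have [N N0 [h1 h2]] := archM h; exists N => //; split; apply: M'Q; apply: MM'.
  have [x xQ] := max_qm_eval qmQ nQ maxQ archQ.
  have /posf : forall h, M h -> 0 <= peval x h by move=> h /MM' /M'Q /xQ.
  rewrite ltNge -oppr_ge0 => /negP; apply; rewrite -mevalN; apply: xQ; apply: M'Q.
  exists 0, 1; split; last by rewrite mul1r add0r.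
    by rewrite -mpolyC0; apply: (qmC qmM).
  by rewrite -(expr1n _ 2); apply: sos_poly_sqr.
have Mt : M (t * f - 1) by have -> : t * f - 1 = s by rewrite -[X in _ + X]opprK e; ring.
have [N1 N10 [N1t _]] := archM t.
have [N2 N20 [N2t _]] := archM (t ^+ 2 * f).
(* One constant bounds both [t] and [t^2 f], as the decreasing step requires. *)
pose N := N1 + N2.
have N0 : 0 < N by rewrite addr_gt0.
have Nt : M (N%:C - t) by apply: (qm_le_C qmM) N1t; rewrite lerDl ltW.
have Ntf : M (N%:C - t ^+ 2 * f) by apply: (qm_le_C qmM) N2t; rewrite lerDr ltW.
have Mtt : M (t * (N%:C + (N%:C - t))).
  by apply: (qm_sos qmM) => //; apply: (qmD qmM) => //; apply: (qmC qmM); apply: ltW.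
have step r : 0 <= r -> M (r%:C + f) -> M ((r - N^-1)%:C + f).
  move=> r0 Mr.
  have NV : N%:C * (N^-1)%:C = 1 :> poly by rewrite -rmorphM /= mulfV ?mpolyC1 // lt0r_neq0.
  have -> : (r - N^-1)%:C + f = (N^-1)%:C ^+ 2 * ((N%:C - t) ^+ 2 * (r%:C + f)
      + (2 * N)%:C * (t * f - 1) + r%:C * (t * (N%:C + (N%:C - t))) + (N%:C - t ^+ 2 * f)).
    have -> : (N%:C - t) ^+ 2 * (r%:C + f) + (2 * N)%:C * (t * f - 1)
       + r%:C * (t * (N%:C + (N%:C - t))) + (N%:C - t ^+ 2 * f) =
       N%:C ^+ 2 * (r%:C + f) - N%:C by rewrite rmorphM rmorph_nat; ring.
    have -> : N%:C ^+ 2 * (r%:C + f) - N%:C = N%:C ^+ 2 * (r%:C + f - (N^-1)%:C).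
      by rewrite mulrBr expr2 -[N%:C * _ * (N^-1)%:C]mulrA NV mulr1.
    by rewrite mulrA -exprMn [(N^-1)%:C * _]mulrC NV expr1n mul1r rmorphB /=; ring.
  apply: (qmM2 qmM); apply: (qmD qmM) => //; apply: (qmD qmM); last exact: (qmZ qmM).
  by apply: (qmD qmM); [apply: (qmM2 qmM) | apply: (qmZ qmM) => //; rewrite mulr_ge0 // ltW].
have [r0 r00 [_ Mr0]] := archM f.
have [k rk] : exists k : nat, r0 < k%:R * N^-1.
  exists (Num.bound (r0 * N)); rewrite -ltr_pdivrMr ?invr_gt0 // invrK.
  by rewrite archi_boundP ?mulr_ge0 ?ltW.
(* [r] is less than [k] steps of size [1 / N], so it turns negative in time; from a negative [r],
   adding [- r] yields [f]. *)
elim: k r0 rk Mr0 {r00} => [|k IHk] r rk Mr.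
  by have := qm_le_C qmM (ltW rk) Mr; rewrite mul0r mpolyC0 add0r.
have [r0|r0] := leP 0 r; last first.
  by have := qm_le_C qmM (ltW r0) Mr; rewrite mpolyC0 add0r.
apply: (IHk (r - N^-1)); last exact: step.
by rewrite ltrBlDr -[X in _ + X]mul1r -mulrDl natr1.
Qed.

End QuadraticModule.

(** * The quadratic module of [g]: membership, bounds and approximate inverses on K *)

Section Putinar.
Variables (R : realType) (n q : nat) (g : 'I_q -> mpoly n R).
Local Notation poly := (mpoly n R).
Local Notation "c %:C" := (mpolyC n c) (at level 1, format "c %:C").

Lemma sos_poly_ge0 (x : 'rV[R]_n) (s : poly) : sos_poly s -> 0 <= peval x s.
Proof.
by move=> [l ->]; rewrite /peval rmorph_sum sumr_ge0 // => h _; rewrite rmorphXn sqr_ge0.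
Qed.

Definition putinar_module : set poly :=
  [set f | exists (s0 : poly) (s : 'I_q -> poly),
    [/\ sos_poly s0, forall j, sos_poly (s j) & f = s0 + \sum_(j < q) g j * s j]].

Lemma quadratic_putinar_module : quadratic_module putinar_module.
Proof.
split=> [|f h [s0 [s [ss0 ss ->]]] [t0 [t [st0 st ->]]]|h f [s0 [s [ss0 ss ->]]]].
- exists 1, (fun=> 0); split=> [|j|]; [|exact: sos_poly0|].
    by rewrite -(expr1n _ 2); apply: sos_poly_sqr.
  by rewrite big1 ?addr0 // => j _; rewrite mulr0.
- exists (s0 + t0), (fun j => s j + t j); split=> [|j|]; [exact: sos_polyD..|].
  by rewrite addrACA -big_split; congr (_ + _); apply: eq_bigr => j _; rewrite mulrDr.
exists (h ^+ 2 * s0), (fun j => h ^+ 2 * s j); split=> [|j|]; [exact: sos_polyM2..|].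
by rewrite mulrDr mulr_sumr; congr (_ + _); apply: eq_bigr => j _; rewrite mulrCA.
Qed.

Lemma putinar_module_g j : putinar_module (g j).
Proof.
exists 0, (fun i => (i == j)%:R ^+ 2); split=> [|i|].
- exact: sos_poly0.
- exact: sos_poly_sqr.
rewrite add0r (bigD1 j) //= eqxx expr1n mulr1 big1 ?addr0 // => i /negPf->.
by rewrite expr0n mulr0.
Qed.

Lemma putinar_module_ge0 (x : 'rV[R]_n) f :
  semialg_set g x -> putinar_module f -> 0 <= peval x f.
Proof.
move=> Kx [s0 [s [ss0 ss ->]]]; rewrite /peval rmorphD rmorph_sum addr_ge0 ?sos_poly_ge0 //.
by apply: sumr_ge0 => j _; rewrite rmorphM mulr_ge0 ?Kx // sos_poly_ge0.
Qed.

Hypothesis archK : archimedean g.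

Lemma putinar_module_bounded f : exists2 N : R, 0 < N &
  putinar_module (N%:C - f) /\ putinar_module (N%:C + f).
Proof.
have [s0 [s [r [ss0 ss e]]]] := archK.
apply: (qm_archimedean quadratic_putinar_module (r := r)).
by rewrite -e; exists s0, s.
Qed.

(** A point where the whole module is nonnegative satisfies every [g j >= 0], hence lies in K. *)
Lemma putinar f : (forall x, semialg_set g x -> 0 < peval x f) -> putinar_module f.
Proof.
move=> fK; apply: positivstellensatz.
- exact: quadratic_putinar_module.
- exact: putinar_module_bounded.
by move=> x Mx; apply: fK => j; apply: Mx; apply: putinar_module_g.
Qed.

Lemma bounded_on_semialg f : exists2 N : R, 0 < N &
  forall x, semialg_set g x -> `|peval x f| <= N.
Proof.
have [N N0 [Nm Np]] := putinar_module_bounded f; exists N => // x Kx.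
have := putinar_module_ge0 Kx Nm; have := putinar_module_ge0 Kx Np.
by rewrite /peval rmorphB rmorphD /= mevalC ler_norml => ? ?; apply/andP; split; lra.
Qed.

(** A truncated geometric series in [1 - f / M], with [M] an upper bound of [f]: then
    [1 - f p = (1 - f / M)^L], whose base lies between 0 and [1 - c / M < 1]. *)
Lemma approx_inverse (f : poly) (c delta : R) : 0 < c -> 0 < delta ->
  (forall x, semialg_set g x -> c <= peval x f) ->
  exists p, forall x, semialg_set g x ->
    0 <= peval x p /\ 0 <= 1 - peval x f * peval x p <= delta.
Proof.
move=> c0 d0 cf; have [M0 M00 fM0] := bounded_on_semialg f.
(* Adding [c] keeps [c / M <= 1] even when K is empty. *)
pose M := M0 + c; have M_gt0 : 0 < M by rewrite addr_gt0.
have [L thL] : exists L, (1 - c / M) ^+ L <= delta.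
  have th1 : `|1 - c / M| < 1.
    by rewrite ger0_norm ?subr_ge0 ?gtrBl ?divr_gt0 // ler_pdivrMr // mul1r lerDr ltW.
  have /cvgrPdist_lt/(_ _ d0) [L _ /(_ L (leqnn L))] := cvg_expr th1.
  by rewrite sub0r normrN => /ltW h; exists L; apply: le_trans h; apply: ler_norm.
exists ((M^-1)%:C * \sum_(k < L) (1 - (M^-1)%:C * f) ^+ k) => x Kx.
have := cf x Kx; have := fM0 x Kx; rewrite /peval; set y := meval _ f => yM cy.
have y0 : 0 < y by apply: lt_le_trans cy.
have -> : meval (fun i => x 0 i) ((M^-1)%:C * \sum_(k < L) (1 - (M^-1)%:C * f) ^+ k) =
    M^-1 * \sum_(k < L) (1 - M^-1 * y) ^+ k.
  rewrite rmorphM rmorph_sum /= mevalC; congr (_ * _); apply: eq_bigr => k _.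
  by rewrite rmorphXn rmorphB rmorph1 rmorphM /= mevalC.
have th0 : 0 <= 1 - M^-1 * y.
  rewrite subr_ge0 mulrC ler_pdivrMr // mul1r /M; have := ler_norm y; lra.
have -> : 1 - y * (M^-1 * \sum_(k < L) (1 - M^-1 * y) ^+ k) = (1 - M^-1 * y) ^+ L.
  have := subrX1 (1 - M^-1 * y) L; set S := \sum_(k < L) _ => e.
  by rewrite -[RHS](subrK 1) e; ring.
split.
  by rewrite mulr_ge0 ?invr_ge0 ?(ltW M_gt0) // sumr_ge0 // => k _; rewrite exprn_ge0.
rewrite exprn_ge0 //=; apply: le_trans thL; apply: lerXn2r; rewrite ?nnegrE //.
  by rewrite subr_ge0 ler_pdivrMr // mul1r lerDr ltW.
by rewrite lerD2l lerN2 mulrC ler_pM2l ?invr_gt0.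
Qed.

End Putinar.

(** * Sums of squares of polynomial matrices and their extension from cliques *)

Section SumsOfSquares.
Variables (R : realType) (n : nat).
Local Notation poly := (mpoly n R).

Lemma sos_mx0 m : sos_mx (0 : 'M[poly]_m).
Proof. by exists 0%N, 0; rewrite mulmx0. Qed.

Lemma sos_mxD m (A B : 'M[poly]_m) : sos_mx A -> sos_mx B -> sos_mx (A + B).
Proof.
move=> [r [H ->]] [r' [H' ->]]; exists (r + r')%N, (col_mx H H').
by rewrite tr_col_mx mul_row_col.
Qed.

Lemma sos_mx_rank1 m (s : poly) (w : 'cV[poly]_m) :
  sos_poly s -> sos_mx (s *: (w *m w^T)).
Proof.
case=> l ->; rewrite scaler_suml.
apply: big_ind => [||h _]; [exact: sos_mx0|exact: sos_mxD|].
exists 1%N, (h *: w^T).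
have -> : (h *: w^T)^T = h *: w by apply/matrixP => i j; rewrite !mxE.
by rewrite -scalemxAl -scalemxAr scalerA expr2.
Qed.

(** [E^T E] is the diagonal projection onto the coordinates in [C]. *)
Lemma clique_mx_colK (A : comNzRingType) m (C : {set 'I_m}) (v : 'cV[A]_m) :
  (forall i, v i 0 != 0 -> i \in C) ->
  (clique_mx A C)^T *m (clique_mx A C *m v) = v.
Proof.
move=> vC; apply/matrixP => j k; rewrite (ord1 k) mxE.
have Ev (i : 'I_#|C|) : (clique_mx A C *m v) i 0 = v (enum_val i) 0.
  rewrite mxE (bigD1 (enum_val i)) //= mxE eqxx mul1r big1 ?addr0 // => l.
  by rewrite eq_sym => /negPf il; rewrite mxE il mul0r.
transitivity (\sum_(i in C) (i == j)%:R * v i 0).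
  rewrite (@big_enum_val _ _ _ _ (pred_of_set C)).
  by apply: eq_bigr => i _; rewrite Ev !mxE.
have [jC|jC] := boolP (j \in C).
  by rewrite (bigD1 j) //= eqxx mul1r big1 ?addr0 // => i /andP[_ /negPf->]; rewrite mul0r.
rewrite big1 => [|i iC]; last by case: eqP iC => [->|]; rewrite ?(negPf jC) ?mul0r.
by apply/esym/eqP; apply: contraNT jC; apply: vC.
Qed.

Variables (q m t : nat) (g : 'I_q -> poly) (C : 'I_t -> {set 'I_m}).

(** The conclusion of the theorem as a predicate on [P], so that it can be proved stable under
    sums. *)
Definition clique_sos (P : 'M[poly]_m) : Prop :=
  exists (S0 : forall k : 'I_t, 'M[poly]_(#|C k|))
         (S : 'I_q -> forall k : 'I_t, 'M[poly]_(#|C k|)),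
    [/\ forall k, sos_mx (S0 k), forall j k, sos_mx (S j k) &
        P = \sum_(k < t) (clique_mx poly (C k))^T
              *m (S0 k + \sum_(j < q) g j *: S j k) *m clique_mx poly (C k)].

Lemma clique_sos0 : clique_sos 0.
Proof.
exists (fun=> 0), (fun _ _ => 0); split=> [k|j k|]; [exact: sos_mx0..|].
rewrite big1 // => k _; rewrite big1 => [|j _]; last by rewrite scaler0.
by rewrite addr0 mulmx0 mul0mx.
Qed.

Lemma clique_sosD P Q : clique_sos P -> clique_sos Q -> clique_sos (P + Q).
Proof.
move=> [S0 [S [sS0 sS ->]]] [T0 [T [sT0 sT ->]]].
exists (fun k => S0 k + T0 k), (fun j k => S j k + T j k).
split=> [k|j k|]; [exact: sos_mxD..|].
rewrite -big_split; apply: eq_bigr => k _ /=.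
have -> : \sum_(j < q) g j *: (S j k + T j k) =
    \sum_(j < q) g j *: S j k + \sum_(j < q) g j *: T j k.
  by rewrite -big_split; apply: eq_bigr => j _; rewrite scalerDr.
by rewrite [in RHS]addrACA [in RHS]mulmxDr mulmxDl.
Qed.

Lemma clique_sos_rank1 k f (v : 'cV[poly]_m) :
  putinar_module g f -> (forall i, v i 0 != 0 -> i \in C k) ->
  clique_sos (f *: (v *m v^T)).
Proof.
move=> [s0 [s [ss0 ss ->]]] vC.
pose w k' := clique_mx poly (C k') *m v.
have sosb (h : poly) k' : sos_poly h -> sos_mx ((k' == k)%:R *: (h *: (w k' *m (w k')^T))).
  move=> sh; case: eqP => _; last by rewrite scale0r; apply: sos_mx0.
  by rewrite scale1r; apply: sos_mx_rank1.
(* The scalar [(k' == k)%:R] selects the clique without transporting matrices between the dependent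
   sizes [#|C k'|]. *)
exists (fun k' => (k' == k)%:R *: (s0 *: (w k' *m (w k')^T))),
  (fun j k' => (k' == k)%:R *: (s j *: (w k' *m (w k')^T))).
split=> [k'|j k'|]; [exact: sosb..|].
rewrite (bigD1 k) //= [X in _ = _ + X]big1 ?addr0 => [|k' nk]; last first.
  rewrite (negPf nk) scale0r big1 ?addr0 ?mulmx0 ?mul0mx // => j _.
  by rewrite scale0r scaler0.
rewrite eqxx scale1r.
under [in RHS]eq_bigr do rewrite scale1r scalerA.
rewrite -scaler_suml -scalerDl -scalemxAr -scalemxAl; congr (_ *: _).
set E := clique_mx _ _.
have -> : E^T *m (w k *m (w k)^T) *m E = (E^T *m w k) *m (E^T *m w k)^T.
  by rewrite [in RHS]trmx_mul trmxK !mulmxA.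
by rewrite clique_mx_colK.
Qed.

End SumsOfSquares.

(** * Elimination of a simplicial vertex *)

(** Lagrange's identity: the double sum of [(u_i v_j - u_j v_i)^2] is twice the difference of the
    two sides. *)
Lemma cauchy_schwarz (R : realDomainType) (I : finType) (u v : I -> R) :
  (\sum_i u i * v i) ^+ 2 <= (\sum_i u i ^+ 2) * (\sum_i v i ^+ 2).
Proof.
have : 0 <= \sum_i \sum_j (u i * v j - u j * v i) ^+ 2.
  by apply: sumr_ge0 => i _; apply: sumr_ge0 => j _; apply: sqr_ge0.
have -> : \sum_i \sum_j (u i * v j - u j * v i) ^+ 2 =
    \sum_i \sum_j (u i ^+ 2 * v j ^+ 2) + \sum_i \sum_j (u j ^+ 2 * v i ^+ 2)
    - (\sum_i \sum_j (u i * v i) * (u j * v j)) *+ 2.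
  rewrite -big_split -sumrMnl -sumrB /=; apply: eq_bigr => i _.
  rewrite -big_split -sumrMnl -sumrB /=; apply: eq_bigr => j _.
  by rewrite mulr2n; ring.
have -> : \sum_i \sum_j (u j ^+ 2 * v i ^+ 2) = \sum_i \sum_j (u i ^+ 2 * v j ^+ 2).
  by rewrite exchange_big.
have -> : \sum_i \sum_j (u i ^+ 2 * v j ^+ 2) = (\sum_i u i ^+ 2) * (\sum_i v i ^+ 2).
  by rewrite mulr_suml; apply: eq_bigr => i _; rewrite mulr_sumr.
have -> : \sum_i \sum_j (u i * v i) * (u j * v j) = (\sum_i u i * v i) ^+ 2.
  by rewrite expr2 mulr_suml; apply: eq_bigr => i _; rewrite mulr_sumr.
by rewrite -mulr2n -mulrnBl pmulrn_lge0 // subr_ge0.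
Qed.

Section QuadraticForm.
Variables (R : realType) (n m : nat).
Local Notation poly := (mpoly n R).
Implicit Types (x : 'rV[R]_n) (P : 'M[poly]_m) (a b : 'cV[poly]_m) (v : 'I_m -> R).

(** Vectors are functions on indices, so that a single coordinate can be overwritten when a square
    is completed. *)
Definition mxform x P v : R := \sum_i \sum_j peval x (P i j) * v i * v j.

Definition mxdot x b v : R := \sum_i peval x (b i 0) * v i.

Lemma mxformD x P P' v : mxform x (P + P') v = mxform x P v + mxform x P' v.
Proof.
rewrite -big_split; apply: eq_bigr => i _; rewrite -big_split; apply: eq_bigr => j _.
by rewrite mxE /peval rmorphD !mulrDl.
Qed.

Lemma mxform0 x v : mxform x 0 v = 0.
Proof.
by apply: big1 => i _; apply: big1 => j _; rewrite mxE /peval rmorph0 !mul0r.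
Qed.

Lemma mxformZ x f P v : mxform x (f *: P) v = peval x f * mxform x P v.
Proof.
rewrite mulr_sumr; apply: eq_bigr => i _; rewrite mulr_sumr; apply: eq_bigr => j _.
by rewrite mxE /peval rmorphM !mulrA.
Qed.

Lemma mxformN x P v : mxform x (- P) v = - mxform x P v.
Proof. by apply/eqP; rewrite -addr_eq0 -mxformD addNr mxform0. Qed.

Lemma mxform_sum x (I : finType) (A : {set I}) (F : I -> 'M[poly]_m) v :
  mxform x (\sum_(i in A) F i) v = \sum_(i in A) mxform x (F i) v.
Proof.
by apply: (big_morph (fun P => mxform x P v)) => [P P'|]; [apply: mxformD|apply: mxform0].
Qed.

Lemma colrowE a b i j : (a *m b^T) i j = a i 0 * b j 0.
Proof. by rewrite mxE big_ord1 mxE. Qed.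

Lemma scale_colrowE f a b i j : (f *: (a *m b^T)) i j = f * (a i 0 * b j 0).
Proof. by rewrite mxE colrowE. Qed.

Lemma mxform_colrow x a b v : mxform x (a *m b^T) v = mxdot x a v * mxdot x b v.
Proof.
rewrite mulr_suml; apply: eq_bigr => i _; rewrite mulr_sumr; apply: eq_bigr => j _.
by rewrite colrowE /peval rmorphM /= mulrACA mulrA.
Qed.

Lemma mxdot_delta x i v : mxdot x (delta_mx i 0) v = v i.
Proof.
rewrite /mxdot (bigD1 i) //= mxE !eqxx /peval rmorph1 mul1r big1 ?addr0 // => j ji.
by rewrite mxE (negPf ji) rmorph0 mul0r.
Qed.

End QuadraticForm.

Section Elimination.
Variables (R : realType) (n q m : nat) (g : 'I_q -> mpoly n R).
Local Notation poly := (mpoly n R).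
Local Notation "c %:C" := (mpolyC n c) (at level 1, format "c %:C").
Hypothesis archK : archimedean g.
Variable e : rel 'I_m.
Hypotheses (e_sym : ssrbool.symmetric e) (e_irr : irreflexive e) (e_chordal : chordal e).
(** [T] abstracts [clique_sos]: the elimination builds its matrices from 0, sums and rank-one terms
    supported on cliques. *)
Variable T : 'M[poly]_m -> Prop.
Hypotheses (T0 : T 0) (TD : forall P Q, T P -> T Q -> T (P + Q)).
Hypothesis T1 : forall f (v : 'cV[poly]_m),
  (forall x, semialg_set g x -> 0 < peval x f) ->
  clique e [set i | v i 0 != 0] -> T (f *: (v *m v^T)).

Local Notation d_ i := (delta_mx i 0 : 'cV[poly]_m).

(** The graph [e] stays fixed during the elimination, so entries may vanish on edges; only fill-in
    outside [e] is excluded. *)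
Definition supported (W : {set 'I_m}) (P : 'M[poly]_m) : Prop :=
  forall i j, P i j != 0 -> [/\ i \in W, j \in W & (i == j) || e i j].

(** A constant uniform over K, rather than pointwise definiteness, leaves room to absorb the error
    of an approximate Schur complement. *)
Definition coercive (W : {set 'I_m}) (P : 'M[poly]_m) (eps : R) : Prop :=
  forall x, semialg_set g x -> forall v, eps * \sum_(i in W) v i ^+ 2 <= mxform x P v.

(* With [a = P i0 i0] and [b] the rest of column [i0], the [1 / a] of the Schur
   complement is replaced by [a' p ^ 2] with [a' p] close to [1]; the resulting
   off-diagonal error [c = (1 - a' p) b] is absorbed by
   [eta (x^2 + y^2) + 2 c x y = (eta + c) / 2 (x + y)^2 + (eta - c) / 2 (x - y)^2]. *)
Lemma elimination_identity (P : 'M[poly]_m) (i0 : 'I_m) (N : {set 'I_m})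
    (b : 'cV[poly]_m) (a a' p eta : poly) :
  (forall i, b i 0 != 0 -> i \in N) -> a = a' + eta *+ #|N| ->
  P = a' *: ((d_ i0 + p *: b) *m (d_ i0 + p *: b)^T)
    + \sum_(j in N)
      (((2^-1)%:C * (eta + (1 - a' * p) * b j 0)) *: ((d_ i0 + d_ j) *m (d_ i0 + d_ j)^T)
       + ((2^-1)%:C * (eta - (1 - a' * p) * b j 0)) *: ((d_ i0 - d_ j) *m (d_ i0 - d_ j)^T))
    + (P - (a *: (d_ i0 *m (d_ i0)^T) + b *m (d_ i0)^T + d_ i0 *m b^T)
       - ((a' * p ^+ 2) *: (b *m b^T) + eta *: \sum_(j in N) (d_ j *m (d_ j)^T))).
Proof.
move=> bN ->.
(* [P] cancels, leaving an identity between explicit matrices to be checked entrywise. *)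
have addKB (A S X Y : 'M[poly]_m) : A + S = X + Y -> P = A + S + (P - X - Y).
  by move=> ->; rewrite -[P - X - Y]addrA -opprD [RHS]addrC subrK.
apply: addKB.
have h := mpolyC_natVK R n (isT : 0 < 2)%N.
have dD (j l : 'I_m) : (d_ i0 + d_ j) l 0 = (l == i0)%:R + (l == j)%:R.
  by rewrite !mxE !eqxx !andbT.
have dB (j l : 'I_m) : (d_ i0 - d_ j) l 0 = (l == i0)%:R - (l == j)%:R.
  by rewrite !mxE !eqxx !andbT.
have termE (c c' : poly) (u w : 'cV[poly]_m) i k :
    (c *: (u *m u^T) + c' *: (w *m w^T)) i k
    = c * (u i 0 * u k 0) + c' * (w i 0 * w k 0).
  transitivity ((c *: (u *m u^T)) i k + (c' *: (w *m w^T)) i k).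
    exact: mxE.
  by congr (_ + _);
   apply: scale_colrowE.
have o0 : ord0 = 0 :> 'I_1 by [].
apply/matrixP => i k; rewrite !mxE !summxE !big_ord1 !mxE !eqxx !andbT.
under eq_bigr => j jN.
  rewrite termE !dD !dB.
  over.
have bsum l : \sum_(j in N) b j 0 * (l == j)%:R = b l 0.
  have [lN|lN] := boolP (l \in N).
    rewrite (bigD1 l) //= eqxx mulr1 big1 ?addr0 // => j /andP[_ jl].
    by rewrite eq_sym (negPf jl) mulr0.
  rewrite big1 => [|j jN]; first by apply/esym/eqP; apply: contraNT lN; apply: bN.
  by case: eqP lN => [->|]; rewrite ?jN ?mulr0.
set x0 : poly := (i == i0)%:R; set y0 : poly := (k == i0)%:R.
(* In each summand the plus and minus terms combine to [eta] on the squares and [(1 - a' p) b_j] on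
   the cross terms. *)
have -> : \sum_(j in N) ((2^-1)%:C * (eta + (1 - a' * p) * b j 0) *
      ((x0 + (i == j)%:R) * (y0 + (k == j)%:R)) +
     (2^-1)%:C * (eta - (1 - a' * p) * b j 0) *
      ((x0 - (i == j)%:R) * (y0 - (k == j)%:R))) =
    (eta * x0 * y0) *+ #|N| + eta * \sum_(j in N) (i == j)%:R * (k == j)%:R +
    (1 - a' * p) * (x0 * b k 0 + b i 0 * y0).
  transitivity (\sum_(j in N) (eta * x0 * y0 + eta * ((i == j)%:R * (k == j)%:R)
      + (1 - a' * p) * (x0 * (b j 0 * (k == j)%:R) + b j 0 * (i == j)%:R * y0))).
    apply: eq_bigr => j _; set z : poly := (i == j)%:R; set w : poly := (k == j)%:R.
    transitivity ((2^-1)%:C * 2 * (eta * x0 * y0 + eta * (z * w) +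
        (1 - a' * p) * (x0 * (b j 0 * w) + b j 0 * z * y0))); first by ring.
    by rewrite h mul1r.
  rewrite big_split big_split /= sumr_const -mulr_sumr -mulr_sumr big_split /=.
  by rewrite -mulr_sumr -mulr_suml !bsum.
have -> : \sum_(j in N) (d_ j *m (d_ j)^T) i k = \sum_(j in N) (i == j)%:R * (k == j)%:R.
  by apply: eq_bigr => j _; rewrite colrowE !mxE eqxx !andbT.
by rewrite !o0; ring.
Qed.

(** [P'] is an approximate Schur complement. Its fill-in lies between neighbours of [i0], which are
    adjacent by simpliciality; its coercivity follows by testing [P] on a vector with a suitable
    entry at [i0]; and [elimination_identity] writes [P - P'] with positive weights. *)
Lemma eliminate_simplicial (W : {set 'I_m}) (P : 'M[poly]_m) (eps : R) (i0 : 'I_m) :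
  0 < eps -> P^T = P -> supported W P -> coercive W P eps -> simplicial e W i0 ->
  exists P', [/\ P'^T = P', supported (W :\ i0) P',
    exists2 eps', 0 < eps' & coercive (W :\ i0) P' eps' & (T P' -> T P)].
Proof.
move=> eps0 symP supP coP /andP[i0W cN].
have sP i j : P i j = P j i by rewrite -[in LHS]symP mxE.
pose N := [set j in W | e i0 j].
have i0N : i0 \notin N by rewrite inE e_irr andbF.
have NW j : j \in N -> j \in W :\ i0.
  by rewrite !inE => /andP[-> h]; rewrite andbT; apply: contraTneq h => ->; rewrite e_irr.
have cliqueN i j : i \in N -> j \in N -> (i == j) || e i j.
  rewrite !inE => /andP[iW ei] /andP[jW ej]; have [//|ij] := eqVneq i j.
  by apply: (cliqueP _ _ cN); rewrite ?inE ?iW ?jW ?ei ?ej ?orbT.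
pose a := P i0 i0.
pose b : 'cV[poly]_m := \col_i (if i == i0 then 0 else P i i0).
have bN i : b i 0 != 0 -> i \in N.
  rewrite mxE; have [_|ii0] := eqVneq i i0; first by rewrite eqxx.
  by move=> /supP[iW _]; rewrite (negPf ii0) /= inE iW e_sym.
pose D := P - (a *: (d_ i0 *m (d_ i0)^T) + b *m (d_ i0)^T + d_ i0 *m b^T).
have DE i j : D i j = if (i == i0) || (j == i0) then 0 else P i j.
  have -> : D i j = P i j - (a * ((i == i0)%:R * (j == i0)%:R) + b i 0 * (j == i0)%:R
      + (i == i0)%:R * b j 0).
    rewrite /D mxE; congr (_ + _); rewrite mxE; congr (- _).
    rewrite mxE [X in X + _]mxE scale_colrowE !colrowE.
    by rewrite ![delta_mx _ _ _ _]mxE eqxx !andbT.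
  rewrite !mxE; have [->|ii0] := eqVneq i i0; have [->|ji0] := eqVneq j i0 => /=.
  - by rewrite /a; ring.
  - by rewrite [P i0 j]sP; ring.
  - by ring.
  - by ring.
have dotb x v w : (forall i, i != i0 -> v i = w i) -> mxdot x b v = mxdot x b w.
  move=> vw; apply: eq_bigr => i _; have [->|/vw-> //] := eqVneq i i0.
  by rewrite mxE eqxx /peval rmorph0 !mul0r.
have formD x v w : (forall i, i != i0 -> v i = w i) -> mxform x D v = mxform x D w.
  move=> vw; apply: eq_bigr => i _; apply: eq_bigr => j _; rewrite DE.
  have [_|/vw->] := eqVneq i i0; first by rewrite /peval rmorph0 !mul0r.
  have [_|/vw-> //] := eqVneq j i0; by rewrite /peval rmorph0 !mul0r.
have formP x v : mxform x P v =
    peval x a * v i0 ^+ 2 + 2 * mxdot x b v * v i0 + mxform x D v.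
  rewrite /D mxformD mxformN 2!mxformD mxformZ !mxform_colrow !mxdot_delta.
  ring.
have dotb2 x v : mxdot x b v ^+ 2 <=
    peval x (\sum_i b i 0 ^+ 2) * \sum_(i in W :\ i0) v i ^+ 2.
  have -> : mxdot x b v = mxdot x b (fun i => if i \in W :\ i0 then v i else 0).
    apply: eq_bigr => i _; case: ifPn => // iW.
    have -> : b i 0 = 0 by apply/eqP; apply: contraNT iW => /bN /NW.
    by rewrite /peval rmorph0 !mul0r.
  apply: le_trans (cauchy_schwarz _ _) _.
  rewrite le_eqVlt; apply/orP; left; apply/eqP; congr (_ * _).
    by rewrite /peval rmorph_sum; apply: eq_bigr => i _; rewrite rmorphXn.
  rewrite [RHS]big_mkcond /=; apply: eq_bigr => i _.
  by case: ifP => // _; rewrite expr0n.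
have a_ge x : semialg_set g x -> eps <= peval x a.
  move=> Kx; pose v i : R := (i == i0)%:R.
  have := coP x Kx v; rewrite formP /v eqxx expr1n !mulr1.
  rewrite (bigD1 i0) //= eqxx expr1n big1 => [|i /andP[_ /negPf->]]; last by rewrite expr0n.
  rewrite addr0 mulr1 (dotb _ _ (fun=> 0)) => [|i /negPf-> //].
  rewrite (formD _ _ (fun=> 0)) => [|i /negPf-> //].
  rewrite /mxdot big1 => [|i _]; last by rewrite mulr0.
  rewrite /mxform big1 => [|i _]; last by rewrite big1 // => j _; rewrite mulr0.
  by rewrite mulr0 !addr0.
have [B0 B00 bB0] := bounded_on_semialg archK (\sum_i b i 0 ^+ 2).
(* With [B >= 1], the bound [b_j^2 <= B] also gives [|b_j| <= B]. *)
pose B := B0 + 1; have B1 : 1 <= B by rewrite lerDr ltW.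
have Bgt0 : 0 < B by lra.
pose c := eps / 2; have c0 : 0 < c by rewrite divr_gt0.
have cc : eps = c + c by rewrite /c -splitr.
pose d : R := #|N|%:R; have d0 : 0 <= d by rewrite ler0n.
(* This makes [eta + d eta + d eta B / c^2 = c]. The summands cover the subtracted [eta] diagonal,
   the bound [a' >= c], and the replacement of [a] by [a'] in the tested form; the other half of
   [eps] remains. *)
pose den := 1 + d + d * B / c ^+ 2.
have dBc : 0 <= d * B / c ^+ 2
  by apply: divr_ge0; [apply: mulr_ge0 => //; apply: ltW | apply: sqr_ge0].
have den0 : 0 < den by rewrite /den; lra.
pose eta := c / den; have eta0 : 0 < eta by rewrite divr_gt0.
have etaE : eta + d * eta + d * eta * B / c ^+ 2 = c.
  have -> : eta + d * eta + d * eta * B / c ^+ 2 = eta * den by rewrite /den; ring.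
  by rewrite /eta divfK // lt0r_neq0.
have deta : 0 <= d * eta by rewrite mulr_ge0 // ltW.
have detaB : 0 <= d * eta * B / c ^+ 2.
  by apply: divr_ge0; [apply: mulr_ge0 => //; apply: ltW | apply: sqr_ge0].
pose a' := a - eta%:C *+ #|N|.
have a'E x : peval x a' = peval x a - d * eta.
  by rewrite /a' /peval rmorphB rmorphMn /= mevalC -mulr_natl.
have a'_ge x : semialg_set g x -> c <= peval x a'.
  by move=> Kx; rewrite a'E; have := a_ge x Kx; lra.
(* The tolerance [eta / (2 B)] keeps each error [(1 - a' p) b_j] within [eta / 2], so both weights
   in the identity stay positive. *)
have [p pP] := approx_inverse archK c0 (divr_gt0 eta0 (mulr_gt0 (ltr0Sn R 1) Bgt0)) a'_ge.
have p_le x : semialg_set g x -> peval x p <= c^-1.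
  move=> Kx; have [p0 /andP[ap _]] := pP x Kx.
  rewrite -[c^-1]mul1r ler_pdivlMr // mulrC; have := ler_wpM2r p0 (a'_ge x Kx); lra.
pose P' := D - ((a' * p ^+ 2) *: (b *m b^T) + eta%:C *: \sum_(j in N) (d_ j *m (d_ j)^T)).
have P'E i j : P' i j = D i j - (a' * p ^+ 2 * (b i 0 * b j 0)
    + eta%:C * (if i \in N then (i == j)%:R else 0)).
  rewrite /P' mxE; congr (_ + _); rewrite mxE; congr (- _).
  rewrite mxE scale_colrowE; congr (_ + _); rewrite mxE; congr (_ * _); rewrite summxE.
  under eq_bigr do rewrite colrowE ![delta_mx _ _ _ _]mxE eqxx !andbT.
  case: ifPn => iN.
    rewrite (bigD1 i) //= eqxx mul1r big1 ?addr0 => [|k /andP[_]].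
      by rewrite eq_sym.
    by rewrite eq_sym => /negPf->; rewrite mul0r.
  rewrite big1 // => k kN; case: eqP iN => [->|_ _]; last by rewrite mul0r.
  by rewrite kN.
exists P'; split.
- apply/matrixP => i j; rewrite mxE !P'E !DE orbC [P j i]sP [b j 0 * _]mulrC.
  congr (_ - (_ + _ * _)); rewrite [j == i]eq_sym.
  by have [->//|ij] := eqVneq i j; rewrite !if_same.
- move=> i j; rewrite P'E DE.
  have b0 : b i0 0 = 0 by rewrite mxE eqxx.
  have [->|ii0] := eqVneq i i0.
    by rewrite b0 (negPf i0N) /= !(mul0r, mulr0) addr0 subrr eqxx.
  have [->|ji0] := eqVneq j i0.
    by rewrite b0 /= (negPf ii0) !if_same !(mul0r, mulr0) addr0 subrr eqxx.
  (* A nonzero entry of [P'] where [P] vanishes is fill-in, and both indices then lie in [N]. *)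
  rewrite /= => nz; have [Pij|Pij] := eqVneq (P i j) 0; last first.
    by have [iW jW ij] := supP i j Pij; split=> //; rewrite !inE ?ii0 ?ji0.
  have [iN jN] : i \in N /\ j \in N; last by split; [exact: NW|exact: NW|exact: cliqueN].
  have [iN|iN] := boolP (i \in N); have [jN|jN] := boolP (j \in N) => //; move: nz.
  + have bj : b j 0 = 0 by apply/eqP; apply: contraNT jN => /bN.
    have ij : i == j = false by apply: contraNF jN => /eqP <-.
    by rewrite Pij bj iN ij !mulr0 addr0 subrr eqxx.
  + have bi : b i 0 = 0 by apply/eqP; apply: contraNT iN => /bN.
    by rewrite Pij bi (negPf iN) mul0r !mulr0 addr0 subrr eqxx.
  + have bi : b i 0 = 0 by apply/eqP; apply: contraNT iN => /bN.
    by rewrite Pij bi (negPf iN) mul0r !mulr0 addr0 subrr eqxx.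
- exists c => // x Kx v; set S := \sum_(i in _) _.
  have S0 : 0 <= S by apply: sumr_ge0 => i _; apply: sqr_ge0.
  pose u := peval x p; pose beta := mxdot x b v.
  (* The entry [- p (b . v)] at [i0] approximates [- (b . v) / a], which minimizes the form of [P]
     in that coordinate. *)
  pose w i := if i == i0 then - (u * beta) else v i.
  have wv i : i != i0 -> w i = v i by rewrite /w => /negPf->.
  have SN : \sum_(j in N) v j ^+ 2 <= S.
    have NWs : (W :\ i0) :&: N = N.
      by apply/finset.setIidPr/fintype.subsetP => i /NW.
    rewrite /S [X in _ <= X](big_setID N) /= NWs.
    by rewrite lerDl; apply: sumr_ge0 => i _; apply: sqr_ge0.
  have := coP x Kx w; rewrite formP (dotb x w v wv) (formD x w v wv) -/beta.
  have -> : w i0 = - (u * beta) by rewrite /w eqxx.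
  have Sw : S <= \sum_(i in W) w i ^+ 2.
    rewrite (big_setD1 i0) //= ler_wpDl ?sqr_ge0 //.
    rewrite /S le_eqVlt; apply/orP; left; apply/eqP; apply: eq_bigr => i.
    by rewrite !inE => /andP[/wv->].
  have formP' : mxform x P' v = mxform x D v - (peval x a' * u ^+ 2 * beta ^+ 2
      + eta * \sum_(j in N) v j ^+ 2).
    rewrite /P' mxformD mxformN [mxform x (_ *: _ + _) v]mxformD 2!mxformZ.
    rewrite mxform_colrow mxform_sum.
    rewrite /peval mevalC rmorphM rmorphXn /= -/(peval x a') -/(peval x p) -/u -/beta.
    congr (_ - (_ + _ * _)).
    by apply: eq_bigr => j _; rewrite mxform_colrow mxdot_delta expr2.
  have [u0 /andP[au _]] := pP x Kx; have uc := p_le x Kx.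
  have beta2 : beta ^+ 2 <= B * S.
    apply: le_trans (dotb2 x v) _; apply: ler_wpM2r => //.
    apply: le_trans (le_trans (ler_norm _) (bB0 x Kx)) _; by rewrite lerDl.
  rewrite formP'; set QD := mxform x D v; set A' := peval x a' in au *.
  have -> : peval x a = A' + d * eta by rewrite /A' a'E subrK.
  rewrite -/u in u0 au uc; move=> coP'.
  have du : d * eta * u ^+ 2 * beta ^+ 2 <= d * eta * B / c ^+ 2 * S.
    have u2 : u ^+ 2 <= (c ^+ 2)^-1.
      by rewrite -exprVn; apply: lerXn2r; rewrite ?nnegrE ?invr_ge0 // ltW.
    have -> : d * eta * B / c ^+ 2 * S = d * eta * ((c ^+ 2)^-1 * (B * S)) by ring.
    by rewrite -mulrA; apply: ler_wpM2l => //; apply: ler_pM; rewrite ?sqr_ge0.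
  (* The sign of this error is favourable because [p] and [1 - a' p] are both nonnegative on K. *)
  have uau : 0 <= 2 * u * (1 - A' * u) * beta ^+ 2.
    by rewrite mulr_ge0 ?sqr_ge0 // mulr_ge0 // mulr_ge0.
  have etaS : eta * \sum_(j in N) v j ^+ 2 <= eta * S by rewrite ler_wpM2l // ltW.
  have epsS : (c + c) * S <= eps * \sum_(i in W) w i ^+ 2.
    by rewrite -cc ler_wpM2l // ltW.
  have cS : c * S = eta * S + d * eta * S + d * eta * B / c ^+ 2 * S.
    by rewrite -!mulrDl etaE.
  have dS : 0 <= d * eta * S by rewrite mulr_ge0.
  have e1 : (A' + d * eta) * (- (u * beta)) ^+ 2 + 2 * beta * - (u * beta) + QD =
     QD - A' * u ^+ 2 * beta ^+ 2 + d * eta * u ^+ 2 * beta ^+ 2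
     - 2 * u * (1 - A' * u) * beta ^+ 2 by ring.
  rewrite e1 in coP'; lra.
move=> TP'.
rewrite (@elimination_identity P i0 N b a a' p eta%:C bN); last first.
  by rewrite /a' subrK.
have small x j : semialg_set g x -> `|peval x ((1 - a' * p) * b j 0)| < eta.
  move=> Kx; have [u0 /andP[au0 au]] := pP x Kx.
  have -> : peval x ((1 - a' * p) * b j 0) = (1 - peval x a' * peval x p) * peval x (b j 0).
    by rewrite /peval rmorphM rmorphB rmorph1 rmorphM.
  have bB : `|peval x (b j 0)| <= B.
    rewrite -(@ler_pXn2r _ 2) ?nnegrE ?(ltW Bgt0) // real_normK ?num_real //.
    have h : peval x (b j 0) ^+ 2 <= B.
      apply: (@le_trans _ _ B0); last by rewrite lerDl.
      apply: le_trans (le_trans (ler_norm _) (bB0 x Kx)).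
      rewrite /peval rmorph_sum (bigD1 j) //= rmorphXn lerDl.
      by apply: sumr_ge0 => i _; rewrite rmorphXn sqr_ge0.
    by apply: le_trans h _; rewrite expr2 ler_peMl // ltW.
  rewrite normrM (ger0_norm au0); apply: (@le_lt_trans _ _ (eta / 2)); last by lra.
  have -> : eta / 2 = eta / (2 * B) * B by rewrite invfM mulrA divfK // lt0r_neq0.
  by apply: ler_pM.
have half_gt0 x f : `|peval x f| < eta -> 0 < peval x ((2^-1)%:C * (eta%:C + f)).
  rewrite ltr_norml => /andP[h _]; rewrite /peval rmorphM rmorphD /= !mevalC.
  by rewrite mulr_gt0 ?invr_gt0 //; rewrite /peval in h; lra.
(* The vertex [i0] and its neighbours in [W] form a clique, which contains the support of every
   rank-one term below. *)
have clique_sub (v : 'cV[poly]_m) : (forall i, v i 0 != 0 -> (i == i0) || (i \in N)) ->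
    clique e [set i | v i 0 != 0].
  move=> vN; apply: subclique cN; apply/fintype.subsetP => i; rewrite !inE => /vN.
  by case/orP => [/eqP->|]; rewrite ?i0W ?eqxx // inE => /andP[-> ->]; rewrite orbT.
have dj j i : i \notin N -> j \in N -> (d_ j) i 0 = 0.
  move=> iN jN; rewrite mxE; case: eqP => // ij.
  by rewrite ij jN in iN.
have di i : i != i0 -> (d_ i0) i 0 = 0 by move=> /negPf ii0; rewrite mxE ii0.
apply: (TD) TP'; apply: TD.
  apply: T1 => [x Kx|]; first by apply: lt_le_trans (a'_ge x Kx).
  apply: clique_sub => i; apply: contraR; rewrite negb_or => /andP[ii0 iN].
  rewrite mxE di // add0r mxE.
  have -> : b i 0 = 0 by apply/eqP; apply: contraNT iN => /bN.
  by rewrite mulr0.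
apply: big_ind => // j jN; apply: TD; apply: T1.
- by move=> x Kx; apply: half_gt0; apply: small.
- apply: clique_sub => i; apply: contraR; rewrite negb_or => /andP[ii0 iN].
  by rewrite mxE di // dj // addr0.
- by move=> x Kx; apply: half_gt0; rewrite /peval rmorphN normrN; apply: small.
apply: clique_sub => i; apply: contraR; rewrite negb_or => /andP[ii0 iN].
by rewrite mxE di // mxE dj // subr0.
Qed.

(** Induction on the size of [W], removing a simplicial vertex each time; over the empty set the
    support condition forces [P = 0]. *)
Lemma eliminate (W : {set 'I_m}) (P : 'M[poly]_m) (eps : R) :
  0 < eps -> P^T = P -> supported W P -> coercive W P eps -> T P.
Proof.
have [k] := ubnP #|W|; elim: k W P eps => // k IHk W P eps.
rewrite ltnS => Wk eps0 symP supP coP.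
have [W0|/(exists_simplicial e_sym e_irr e_chordal)[i0 si0]] := eqVneq W (finset.set0).
  suff -> : P = 0 by [].
  apply/matrixP => i j; rewrite mxE; apply/eqP; apply: contraT => /supP[].
  by rewrite W0 inE.
have [P' [symP' supP' [eps' eps'0 coP']]] := eliminate_simplicial eps0 symP supP coP si0.
apply; apply: (IHk _ _ eps') supP' coP' => //; apply: leq_trans Wk.
by case/andP: si0 => i0W _; rewrite [X in (_ < X)%N](cardsD1 i0) i0W.
Qed.

End Elimination.

(** * Uniform positive definiteness on a compact set *)

Section Coercivity.
Variables (R : realType) (n m : nat).
Local Notation poly := (mpoly n R).

Lemma peval_continuous (f : poly) : continuous (fun x : 'rV[R]_n => peval x f).
Proof.
elim/mpoly_subalg_ind: f => [c|i|f h cf ch|f h cf ch].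
- rewrite (_ : (fun y : 'rV[R]_n => peval y _) = (fun=> c)); first exact: cst_continuous.
  by apply/funext => y; rewrite /peval mevalC.
- rewrite (_ : (fun y : 'rV[R]_n => peval y _) = (fun y : 'rV[R]_n => y 0 i)).
    exact: coord_continuous.
  by apply/funext => y; rewrite /peval mevalXU.
- rewrite (_ : (fun y : 'rV[R]_n => peval y _) = (fun y : 'rV[R]_n => peval y f + peval y h)).
    by move=> x; apply: continuousD; [exact: cf|exact: ch].
  by apply/funext => y; rewrite /peval rmorphD.
rewrite (_ : (fun y : 'rV[R]_n => peval y _) = (fun y : 'rV[R]_n => peval y f * peval y h)).
  by move=> x; apply: continuousM; [exact: cf|exact: ch].
by apply/funext => y; rewrite /peval rmorphM.
Qed.

Lemma mxformE (x : 'rV[R]_n) (P : 'M[poly]_m) (v : 'cV[R]_m) :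
  mxform x P (fun i => v i 0) = (v^T *m map_mx (peval x) P *m v) 0 0.
Proof.
rewrite mxE /mxform exchange_big; apply: eq_bigr => j _ /=.
by rewrite mxE mulr_suml; apply: eq_bigr => i _; rewrite !mxE [v i 0 * _]mulrC.
Qed.

Lemma mxformZv (x : 'rV[R]_n) (P : 'M[poly]_m) (c : R) v :
  mxform x P (fun i => c * v i) = c ^+ 2 * mxform x P v.
Proof.
rewrite mulr_sumr; apply: eq_bigr => i _; rewrite mulr_sumr; apply: eq_bigr => j _.
ring.
Qed.

(** The form attains a positive minimum on K times the unit sphere, and homogeneity extends the
    bound to all vectors. *)
Lemma posdef_coercive (K : set 'rV[R]_n) (P : 'M[poly]_m) :
  compact K -> (forall x, K x -> posdefmx (map_mx (peval x) P)) ->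
  exists2 eps : R, 0 < eps &
    forall x, K x -> forall v, eps * \sum_i v i ^+ 2 <= mxform x P v.
Proof.
move=> cK posP.
pose F (z : 'rV[R]_n * 'rV[R]_m) : R := mxform z.1 P (fun i => z.2 0 i).
have cP i j : continuous (fun z : 'rV[R]_n * 'rV[R]_m => peval z.1 (P i j)).
  move=> z; apply: (@continuous_comp _ _ _ fst (fun x => peval x (P i j))).
    exact: cvg_fst.
  exact: peval_continuous.
have cv i : continuous (fun z : 'rV[R]_n * 'rV[R]_m => z.2 0 i).
  move=> z; apply: (@continuous_comp _ _ _ snd (fun v : 'rV[R]_m => v 0 i)).
    exact: cvg_snd.
  exact: coord_continuous.
have cF : continuous F.
  apply: continuous_big => [|i _]; first exact: add_continuous.
  apply: continuous_big => [|j _ z]; first exact: add_continuous.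
  exact: (continuousM (continuousM (cP i j z) (cv i z)) (cv j z)).
(* The norm of a row vector is the maximum of its entries in absolute value, whence the dimension
   factor below. *)
pose S : set 'rV[R]_m := [set v | `|v| = 1].
have cS : compact S.
  apply: bounded_closed_compact.
    by exists 1; split => // M M1 v /= ->; apply: ltW.
  apply: (@preimage_closed _ _ (fun v : 'rV[R]_m => `|v|) [set 1]) => [v _|].
    exact: norm_continuous.
  exact: closed_eq.
suff [mu mu0 muP] : exists2 mu : R, 0 < mu & forall z, (K `*` S) z -> mu <= F z.
  (* [m + 1] instead of [m] keeps the divisor positive when [m = 0]. *)
  have m0 : 0 < (m%:R + 1 : R) by rewrite ltr_wpDl.
  exists (mu / (m%:R + 1)) => [|x Kx v]; first by rewrite divr_gt0.
  pose w : 'rV[R]_m := \row_i v i.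
  have [w0|w0] := eqVneq w 0.
    have v0 i : v i = 0 by have := congr1 (fun u : 'rV[R]_m => u 0 i) w0; rewrite !mxE.
    rewrite big1 => [|i _]; last by rewrite v0 expr0n.
    rewrite mulr0 /mxform big1 // => i _; rewrite big1 // => j _.
    by rewrite !v0 mulr0.
  have nw0 : 0 < `|w| by rewrite normr_gt0.
  have -> : mxform x P v = `|w| ^+ 2 * F (x, `|w|^-1 *: w).
    rewrite /F -mxformZv; apply: eq_bigr => i _; apply: eq_bigr => j _ /=.
    by rewrite !mxE !mulVKf // lt0r_neq0.
  have : mu <= F (x, `|w|^-1 *: w).
    apply: muP; split=> //=; rewrite /S /= normrZ normfV normr_id mulVf //.
    by rewrite lt0r_neq0.
  have sumle : \sum_i v i ^+ 2 <= (m%:R + 1) * `|w| ^+ 2.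
    apply: (@le_trans _ _ (\sum_(i < m) `|w| ^+ 2)).
      apply: ler_sum => i _; rewrite -real_normK ?num_real // lerXn2r ?nnegrE //.
      have -> : v i = w 0 i by rewrite mxE.
      rewrite [leRHS]/Num.norm /= mx_normrE; apply/bigmax_geP; right => /=.
      by exists (0, i).
    by rewrite sumr_const card_ord mulrDl mul1r mulr_natl lerDl sqr_ge0.
  move=> muF; apply: (@le_trans _ _ (mu * `|w| ^+ 2)).
    rewrite -mulrA ler_wpM2l ?(ltW mu0) // mulrC ler_pdivrMr //.
    by rewrite mulrC.
  by rewrite mulrC ler_wpM2l ?sqr_ge0.
(* If K is empty or [m = 0], the product is empty and any positive constant serves. *)
have [KS0|KS0] := pselect ((K `*` S) !=set0); last first.
  by exists 1 => // z KSz; case: KS0; exists z.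
have [z /set_mem[Kz Sz] zmin] :=
  compact_EVT_min KS0 (compact_setX cK cS) (continuous_subspaceT cF).
exists (F z); last by move=> z' z'KS; apply: zmin; apply/mem_set.
have [_ /(_ z.2^T)] := posP _ Kz.
rewrite -mxformE.
have -> : mxform z.1 P (fun i => z.2^T i 0) = F z.
  by apply: eq_bigr => i _; apply: eq_bigr => j _; rewrite !mxE.
apply; apply/negP => /eqP/(congr1 trmx); rewrite trmxK trmx0 => z0.
move: Sz; rewrite /S /= z0 normr0 => /esym/eqP; rewrite oner_eq0.
by [].
Qed.

End Coercivity.

Theorem theorem2p4 (R : realType) (n q m t : nat)
    (g : 'I_q -> mpoly n R) (P : 'M[mpoly n R]_m)
    (C : 'I_t -> {set 'I_m})
    (compactK : compact (semialg_set g))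
    (archK : archimedean g)
    (symP : P^T = P)
    (chordalP : chordal (sparsity_graph P))
    (injC : injective C)
    (maxC : forall A : {set 'I_m},
       maxset (clique (sparsity_graph P)) A <-> exists k, C k = A)
    (posP : forall x : 'rV[R]_n, semialg_set g x ->
       posdefmx (map_mx (peval x) P)) :
  exists (S0 : forall k : 'I_t, 'M[mpoly n R]_(#|C k|))
         (S : 'I_q -> forall k : 'I_t, 'M[mpoly n R]_(#|C k|)),
    [/\ forall k, sos_mx (S0 k),
        forall j k, sos_mx (S j k) &
        P = \sum_(k < t)
              (clique_mx (mpoly n R) (C k))^T
                *m (S0 k + \sum_(j < q) g j *: S j k)
                *m clique_mx (mpoly n R) (C k)].
Proof.
have [eps eps0 epsP] := posdef_coercive compactK posP.
have e_sym : ssrbool.symmetric (sparsity_graph P).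
  by move=> i j; rewrite /sparsity_graph /= eq_sym -[in LHS]symP mxE.
have e_irr : irreflexive (sparsity_graph P) by move=> i; rewrite /sparsity_graph /= eqxx.
apply: (eliminate archK e_sym e_irr chordalP (T := clique_sos g C)
  (W := [set: 'I_m]%SET) _ _ _ eps0 symP) => //.
- exact: clique_sos0.
- exact: clique_sosD.
(* The clique supporting [v] extends to a maximal one, which is some [C k]; Putinar's theorem then
   represents [f]. *)
- move=> f v fK cv; have [A maxA vA] := maxset_exists cv.
  have [k Ck] := (maxC A).1 maxA.
  apply: (clique_sos_rank1 (k := k) (putinar archK fK)) => i vi.
  by rewrite Ck; apply: (fintype.subsetP vA); rewrite inE.
- by move=> i j Pij; rewrite !inE /sparsity_graph /= Pij andbT orbN.
by move=> x Kx v; rewrite (eq_bigl xpredT) ?epsP // => i; rewrite inE.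
Qed.
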